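(* Assume that there is a stationary set $S\subseteq\omega_2$ such that (a) $\mathrm{cf}(\alpha)=\omega$ for every $\alpha\in S$, and (b) $S\cap\beta$ is not stationary in $\beta$ for every $\beta<\omega_2$ with $\mathrm{cf}(\beta)=\omega_1$. Then there is a scattered compact space $K$ with empty third Cantor–Bendixson derivative, $K^{(3)}=\emptyset$, such that (i) $K$ is not Corson compact (in fact, $K$ is not $\omega_2$-Corson compact); (ii) if $L$ is a continuous image of $K$ and $w(L)\le\omega_1$, then $L$ is uniform Eberlein compact.
   Context: All topological spaces are Hausdorff; $w(X)$ is the topological weight (minimal size of a base) of $X$. For a limit ordinal $\gamma$, a set $F\subseteq\gamma$ is closed if it is closed in the interval (order) topology on $\gamma$, and unbounded if for every $\beta<\gamma$ there is $\alpha\in F$ with $\beta<\alpha$; $S\subseteq\gamma$ is stationary in $\gamma$ if $S\cap F\ne\emptyset$ for every closed unbounded $F\subseteq\gamma$. A compact space is Corson compact if for some $\kappa$ it is homeomorphic to a subset of $\Sigma(\mathbb R^\kappa)=\{x\in\mathbb R^\kappa: |\{\alpha: x_\alpha\ne0\}|\le\omega\}$ (with the topology inherited from the product $\mathbb R^\kappa$). A compact space is $\omega_2$-Corson compact if for some $\kappa$ it is homeomorphic to a subset of $\{x\in\mathbb R^\kappa: |\{\alpha: x_\alpha\neq 0\}|<\omega_2\}$ (so Corson compact is the same as $\omega_1$-Corson compact). A compact space is uniform Eberlein compact if it is homeomorphic to a weakly compact subset of a Hilbert space. *)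

(* Defs.v *)
From HB Require Import structures.
From mathcomp Require Import all_boot all_order all_algebra.
From mathcomp Require Import sesquilinear wochoice.
From mathcomp Require Import all_classical all_reals all_analysis.

Set Implicit Arguments.
Unset Strict Implicit.
Unset Printing Implicit Defensive.

Import Order.TTheory GRing.Theory Num.Theory.
Import numFieldNormedType.Exports.

Local Open Scope classical_set_scope.
Local Open Scope card_scope.
Local Open Scope ring_scope.

(* An ordinal is represented by a well-ordered type; its elements are the
   smaller ordinals. The predicate below says that the order type of [W] is the
   least ordinal of cardinality greater than that of [C]. So [W] is a copy of
   omega_1 when [C] is [nat], and a copy of omega_2 when [C] is a copy of
   omega_1. *)
Definition least_ordinal_above (C : Type) d (W : orderType d) : Prop :=
  [/\ well_order (<=%O : rel W),
      ~ ([set: W] #<= [set: C]) &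
      forall b : W, [set x : W | (x < b)%O] #<= [set: C]].

(* The ordinal [b], as the type of the ordinals smaller than [b]. *)
Definition below d (W : orderType d) (b : W) : orderType d :=
  sub_type {x : W | (x < b)%O}.

Definition trace_below d (W : orderType d) (S : set W) (b : W) :
  set (below b) := [set x | S (\val x)].
Arguments trace_below {d W} S b.

Definition unbounded d (T : orderType d) (F : set T) : Prop :=
  forall b : T, exists2 a, F a & (b < a)%O.

Definition club d (T : orderType d) (F : set T) : Prop :=
  closed (F : set (order_topology T)) /\ unbounded F.

Definition stationary d (T : orderType d) (S : set T) : Prop :=
  forall F : set T, club F -> S `&` F !=set0.

(* [cofinality_is T C]: the cofinality of the ordinal [T] is the cardinality of
   the infinite type [C]. It fails when [T] is not a nonzero limit ordinal: a
   nonempty [T] with a greatest element has no subset that is unbounded in the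
   strict sense used here. *)
Definition cofinality_is d (T : orderType d) (C : Type) : Prop :=
  (exists2 A : set T, unbounded A & A #= [set: C]) /\
  (forall A : set T, unbounded A -> [set: C] #<= A).

Definition compact_hausdorff (X : topologicalType) : Prop :=
  compact [set: X] /\ hausdorff_space X.

Definition homeomorphic (X Y : topologicalType) : Prop :=
  exists (f : X -> Y) (g : Y -> X),
    [/\ continuous f, continuous g, cancel f g & cancel g f].

Definition weight_le (X : topologicalType) (C : Type) : Prop :=
  exists2 B : set (set X), basis B & B #<= [set: C].

Definition scattered (X : topologicalType) : Prop :=
  forall A : set X, A !=set0 -> isolated A !=set0.

Definition CB_derivative (X : topologicalType) (A : set X) : set X :=
  A `\` isolated A.

Definition CB_derived (X : topologicalType) (n : nat) : set X :=
  iter n (@CB_derivative X) [set: X].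
Arguments CB_derived : clear implicits.

Definition supp (R : realType) (I : Type) (x : {ptws I -> R}) : set I :=
  [set i | x i <> 0].

Definition Corson_compact (R : realType) (X : topologicalType) : Prop :=
  compact_hausdorff X /\
  exists (I : Type) (A : set {ptws I -> R}),
    (forall x, A x -> countable (supp x)) /\ homeomorphic X (set_type A).

(* [W] is a copy of omega_2 (or of another initial ordinal), and the condition
   on supports is |supp x| < |W|. *)
Definition lt_Corson_compact (R : realType) (W : Type) (X : topologicalType) :
    Prop :=
  compact_hausdorff X /\
  exists (I : Type) (A : set {ptws I -> R}),
    (forall x, A x -> ~ ([set: W] #<= supp x)) /\ homeomorphic X (set_type A).

Definition continuous_dual (R : realType) (E : normedModType R) : Type :=
  {phi : {scalar E} | continuous (phi : E -> R)}.

Definition weak_space (R : realType) (E : normedModType R) : topologicalType :=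
  sup_topology (fun phi : continuous_dual E =>
    Topological.class (initial_topology (sval phi : E -> R))).

(* A Hilbert space over [R] is a complete normed module whose norm comes from a
   positive definite symmetric bilinear form. *)
Definition hilbert_norm (R : realType) (H : normedModType R)
    (dot : {dot H for idfun}) : Prop :=
  forall x : H, `|x| ^+ 2 = dot x x.

Definition uniform_Eberlein_compact (R : realType) (X : topologicalType) :
    Prop :=
  compact_hausdorff X /\
  exists (H : completeNormedModType R) (dot : {dot H for idfun})
         (A : set (weak_space H)),
    [/\ hilbert_norm dot, compact A & homeomorphic X (set_type A)].

(* Main.v *)
From HB Require Import structures.
Require Import Defs.
From mathcomp Require Import all_boot all_order all_algebra finmap.
From mathcomp Require Import sesquilinear ring lra.
From mathcomp Require Import all_classical all_reals all_analysis.
From mathcomp Require Import summability.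

(** The space [K] is the one-point compactification of the Psi-like space of a
ladder system. For each [a] in [S] fix a nondecreasing sequence [l a] of
ordinals cofinal in [a]. The points of [K] are an isolated point (a rung) for
every ordinal below omega_2, a point (a tip) for every [a], to which the rungs
of the ladder [l a] converge when [a] is in [S], and a point at infinity. This
space is compact, Hausdorff and scattered of height at most three.

[K] is not omega_2-Corson. Let [h] embed [K] in a power of the reals, with
supports of cardinality at most omega_1. For [a] in [S] choose a coordinate [i]
that separates the tip of [a] from infinity, and then a rung [f a < a] of the
ladder of [a] that is separated from infinity by the same [i]. So [i] lies in
the support of [h] at [f a] or at infinity. Given the value [f a], this leaves
only omega_1 many coordinates [i], and each coordinate separates only countably
many tips from infinity, because the point at infinity has neighbourhoods that
miss only finitely many tips. Hence the regressive function [f] on the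
stationary set [S] has fibres of cardinality at most omega_1, which is
impossible in the regular cardinal omega_2 ([regressive_fiber]).

Let [g] map [K] onto a space [L] of weight at most omega_1. All but countably
many points of [K] are mapped into any given neighbourhood of the image of
infinity, and omega_1 many neighbourhoods shrink to that point; so [g] is
constant on the rungs and tips of all ordinals from some [b < omega_2] on. Since [S] reflects at no
ordinal of cofinality omega_1, induction on [b] gives tails of the ladders
[l a], [a <= b] in [S], which are pairwise disjoint ([exists_tails_disjoint]): at a
limit ordinal, a cofinal set that accumulates at no point of [S] cuts the
ordinal into intervals, and the ladders can be handled one interval at a time.

Call [p] the image of infinity and [D] the set of the other images of tips of
[S]. The points of [L] outside [D] and [p] are isolated, and each [y] in [D]
has an open countable neighbourhood consisting of [y] and of isolated points.
As the tails are disjoint, each such neighbourhood meets only countably many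
others, and two of them have a finite intersection. The components of this
intersection graph are therefore countable
([locally_countable_orientation]), and an enumeration of each component turns
the neighbourhoods into pairwise disjoint ones. Then [L] embeds in a Hilbert
space with the weak topology: send [p] to 0, a point [y] of [D] to a basis
vector, and an isolated point [x] to its own basis vector, plus that of [y] if
[x] is in the neighbourhood of [y]. The map is weakly continuous because a
bounded functional is large on finitely many basis vectors only
([disjoint_neighborhoods_uniform_Eberlein]). The Hilbert space is the space
[l2 R I] of the square summable families indexed by an arbitrary set [I]. *)

Set Implicit Arguments.
Unset Strict Implicit.
Unset Printing Implicit Defensive.

Import Order.TTheory GRing.Theory Num.Theory.
Import numFieldNormedType.Exports.

Local Open Scope classical_set_scope.
Local Open Scope card_scope.

(** * Cardinals and well-orders *)

Lemma card_le_injP T U (A : set T) (B : set U) :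
  (exists2 f : T -> U, {in A &, injective f} & forall x, A x -> B (f x)) ->
    A #<= B.
Proof.
move=> [f finj fAB]; have := inj_card_eq finj;
  rewrite card_eq_sym card_eq_le => /andP[Af _].
by apply: card_le_trans Af _; apply: subset_card_le => _ [x Ax <-]; exact: fAB.
Qed.

Lemma card_leTP T U (u0 : U) (A : set T) :
  A #<= [set: U] -> exists f : T -> U, {in A &, injective f}.
Proof.
pose pU := HB.pack U (gen_eqMixin U) (gen_choiceMixin U) (isPointed.Build U u0) :
  pointedType.
by move=> /(@pcard_injP T pU).
Qed.

Lemma wf_min T (r : T -> T -> Prop) :
  (forall P : set T, P !=set0 -> exists2 m, P m & forall y, P y -> ~ r y m) ->
    well_founded r.
Proof.
move=> h x; apply: contrapT => nx.
have [m nm mm] := h [set x | ~ Acc r x] (ex_intro _ x nx).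
by apply: nm; constructor => y rym; apply: contrapT => /mm; exact.
Qed.

(** A recursion along [r] picks pairwise distinct elements of [A]: the initial
segments of [r] are too small to exhaust [A]. *)
Lemma card_le_wf T U C (r : T -> T -> Prop) (A : set U) :
  well_founded r -> (forall x y, [\/ r x y, x = y | r y x]) ->
  (forall z, [set y | r y z] #<= [set: C]) -> ~ (A #<= [set: C]) ->
    [set: T] #<= A.
Proof.
move=> rwf rtri rC AC.
have [u0 Au0] : A !=set0 by apply/set0P; apply: contra_notN AC => /eqP ->;
  exact: card_ge0.
have ex z (h : T -> U) : exists u, A u /\ forall y, r y z -> h y <> u.
  apply: contrapT => nex; apply: AC.
  apply: (@card_le_trans _ _ _ (h @` [set y | r y z])).
    apply: subset_card_le => u Au; apply: contrapT => nu; apply: nex.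
    by exists u; split => // y ryz hy; apply: nu; exists y.
  by apply: card_le_trans (rC z); exact: card_image_le.
pose P z (h : forall y, r y z -> U) u := A u /\ forall y (H : r y z), h y H <> u.
have Pex z h : exists u, @P z h u.
  have [u [Au hu]] := ex z (fun y =>
    if pselect (r y z) is left H then h y H else u0).
  exists u; split => // y H; have := hu _ H; case: pselect => // H'.
  by rewrite (Prop_irrelevance H' H).
pose F z h := projT1 (cid (@Pex z h)).
pose f := Fix rwf (fun=> U) F.
have fE z : f z = F z (fun y _ => f y).
  apply: Fix_eq => x g h gh; congr (F x _).
  by apply: functional_extensionality_dep => y;
    apply: functional_extensionality_dep => H.
have fP z : A (f z) /\ forall y, r y z -> f y <> f z.
  by rewrite [f z]fE /F; case: cid => u [].
apply: card_le_injP; exists f; last by move=> z _; exact: (fP z).1.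
move=> x y _ _ fxy; case: (rtri x y) => // h.
- by case: ((fP y).2 _ h).
- by case: ((fP x).2 _ h).
Qed.

(** An infinite type whose square embeds in it. Then [C] many sets of
cardinality at most [C] have a union of cardinality at most [C]. *)
Definition absorbing C := [set: C * C] #<= [set: C] /\ [set: nat] #<= [set: C].

Lemma card_bigcup_le I T C (D : set I) (F : I -> set T) : absorbing C ->
  D #<= [set: C] -> (forall i, D i -> F i #<= [set: C]) ->
    \bigcup_(i in D) F i #<= [set: C].
Proof.
move=> [CC nC] DC FC; apply: card_le_trans CC.
have [c0] : inhabited C.
  apply: contrapT => nc; have C0 : [set: C] = set0.
    by rewrite -subset0 => c _; apply: nc.
  by move: nC; rewrite C0 => /card_le0P; rewrite -subset0 => /(_ 0%N); apply.
have [d dinj] := card_leTP c0 DC.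
have [->|/set0P[x0 [i0 Di0 Fx0]]] := eqVneq (\bigcup_(i in D) F i) set0;
  first exact: card_ge0.
have exi x : exists i, (\bigcup_(i in D) F i) x -> D i /\ F i x.
  have [[i Di Fi]|nx] := pselect ((\bigcup_(i in D) F i) x); first by exists i.
  by exists i0.
pose ix x := projT1 (cid (exi x)).
have ixP x : (\bigcup_(i in D) F i) x -> D (ix x) /\ F (ix x) x
  by exact: (projT2 (cid (exi x))).
have exf i : exists f : T -> C, D i -> {in F i &, injective f}.
  have [Di|nDi] := pselect (D i); first by have [f fi] := card_leTP c0 (FC i Di);
    exists f.
  by exists (fun=> d i0).
pose f i := projT1 (cid (exf i)).
have fP i : D i -> {in F i &, injective (f i)} by exact: (projT2 (cid (exf i))).
apply: card_le_injP; exists (fun x => (d (ix x), f (ix x) x)) => //.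
move=> x y /set_mem/ixP[Dx Fx] /set_mem/ixP[Dy Fy] [/dinj e].
rewrite -e ?inE//; apply: fP => //; rewrite inE //; by rewrite e ?inE.
Qed.

Lemma absorbing_nat : absorbing nat.
Proof.
split; last exact: card_lexx.
by have := card_nat2; rewrite card_eq_le => /andP[].
Qed.

Lemma absorbing_set1 T C (x : T) : absorbing C -> [set x] #<= [set: C].
Proof. by move=> [_]; apply: card_le_trans; exact: countable1. Qed.

Lemma absorbing_setU T C (A B : set T) : absorbing C ->
  A #<= [set: C] -> B #<= [set: C] -> A `|` B #<= [set: C].
Proof.
move=> aC AC BC; rewrite -bigcup2E; apply: card_bigcup_le => //;
  first exact: aC.2.
by move=> [|[|n]] _ //=; exact: card_ge0.
Qed.

Lemma countable_absorbing T C (A : set T) : absorbing C -> countable A ->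
  A #<= [set: C].
Proof. by move=> [_]; rewrite /countable => h /card_le_trans; exact. Qed.

Section least_ordinal_above.
Local Open Scope order_scope.
Context {C : Type} {d} {W : orderType d}.
Hypothesis aC : absorbing C.
Hypothesis WP : least_ordinal_above C W.

Lemma wo_minP (P : set W) : P !=set0 -> exists2 m, P m & forall y, P y -> m <= y.
Proof.
case: WP => wo _ _ [x Px].
have [|m [[/asboolP mP mm] _]] := wo (fun y => `[< P y >]); first by exists x;
  exact/asboolP.
by exists m => // y Py; apply: mm; exact/asboolP.
Qed.

Lemma lt_wf : well_founded (fun x y : W => x < y).
Proof.
apply: wf_min => P /wo_minP[m Pm mm]; exists m => // y /mm my.
by apply/negP; rewrite -leNgt.
Qed.

Lemma card_seg (b : W) : [set x | x < b] #<= [set: C]. Proof. by case: WP. Qed.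

Lemma card_segW (b : W) : [set x | x <= b] #<= [set: C].
Proof.
apply: (@card_le_trans _ _ _ ([set x | x < b] `|` [set b])); last first.
  by apply: absorbing_setU (card_seg b) (absorbing_set1 _ _).
apply: subset_card_le => x /=; rewrite le_eqVlt => /predU1P[->|];
  [by right|by left].
Qed.

(** The successor cardinal [W] is regular. *)
Lemma card_bounded (A : set W) :
  A #<= [set: C] -> exists b, forall a, A a -> a < b.
Proof.
move=> AC; apply: contrapT => nb; case: WP => _ nW _; apply: nW.
apply: (@card_le_trans _ _ _ (\bigcup_(a in A) [set x | x <= a])); last first.
  by apply: card_bigcup_le => // a _; exact: card_segW.
apply: subset_card_le => b _; apply: contrapT => h; apply: nb.
exists b => a Aa; rewrite ltNge; apply/negP => ba; apply: h; by exists a.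
Qed.

Lemma no_max (a : W) : exists b, a < b.
Proof.
have [b hb] := card_bounded (absorbing_set1 a aC); by exists b; exact: hb.
Qed.

Lemma succ_ex (a : W) : exists2 s, a < s & forall x, x < s -> x <= a.
Proof.
have [s as_ hs] := wo_minP (no_max a).
by exists s => // x xs; rewrite leNgt; apply/negP => /hs; rewrite leNgt xs.
Qed.

Lemma sup_ex (A : set W) : A #<= [set: C] ->
  exists2 s, forall a, A a -> a <= s &
    forall b, (forall a, A a -> a <= b) -> s <= b.
Proof.
move=> /card_bounded[b hb].
have [|s sP sm] := @wo_minP [set s | forall a, A a -> a <= s].
  by exists b => a /hb/ltW.
by exists s.
Qed.

Lemma card_le_of_not T (A : set T) : ~ ([set: W] #<= A) -> A #<= [set: C].
Proof.
move=> nWA; apply: contrapT => nAC; apply: nWA.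
apply: card_le_wf lt_wf _ card_seg nAC => x y.
by case: (ltgtP x y) => h; [apply: Or31|apply: Or33|apply: Or32].
Qed.

(** The pairs are well-ordered by their maximum first, and then
lexicographically; the initial segments have cardinality at most [C]. *)
Lemma absorbing_succ : absorbing W.
Proof.
have natW : [set: nat] #<= [set: W].
  apply/infiniteP => fW; case: WP => _ nW _; apply: nW.
  exact: countable_absorbing aC (finite_set_countable fW).
split => //.
pose mx (p : W * W) := Order.max p.1 p.2.
pose r (p q : W * W) := mx p < mx q \/ (mx p = mx q /\ (p.1 < q.1 \/
  (p.1 = q.1 /\ p.2 < q.2))).
apply: (@card_le_wf _ _ C r).
- apply: wf_min => P P0.
  have [|m [p Pp pm] mm] := @wo_minP (mx @` P); first by case: P0 => p Pp;
    exists (mx p), p.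
  have [|a [q [Pq qm] qa] am] := @wo_minP (fst @` [set p | P p /\ mx p = m]).
    by exists p.1, p.
  have [|b [t [[Pt tm] ta] tb] bm] := @wo_minP (snd @` [set p | (P p /\
    mx p = m) /\ p.1 = a]).
    by exists q.2, q.
  exists t => // y Py [|[]].
    by rewrite tm ltNge mm//; exists y.
  rewrite tm => ym [|[]].
    by rewrite ta ltNge am//; exists y.
  by rewrite ta => ya; rewrite tb ltNge bm//; exists y.
- move=> [a b] [c e]; rewrite /r.
  have [h|h|->] := ltgtP (mx (a, b)) (mx (c, e)); [by apply: Or31;
    left|by apply: Or33; left|].
  have [h|h|->] := ltgtP a c; [by apply: Or31; right; split => //;
    left|by apply: Or33; right; split => //; left|].
  have [h|h|->] := ltgtP b e; [by apply: Or31; right; split => //;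
    right|by apply: Or33; right; split => //; right|].
  exact: Or32.
- move=> q; apply: (@card_le_trans _ _ _ (\bigcup_(a in [set x | x <= mx q])
    ((fun b => (a, b)) @` [set x | x <= mx q]))).
    apply: subset_card_le => p /= rpq.
    have : mx p <= mx q by case: rpq => [/ltW //|[-> _]].
    rewrite ge_max => /andP[p1 p2]; exists p.1 => //; exists p.2 => //;
      by case: (p).
  apply: card_bigcup_le => //; first exact: card_segW.
  by move=> a _; apply: card_le_trans (card_segW (mx q)); exact: card_image_le.
- by case: WP.
Qed.

(** The form of the pressing-down lemma that is needed. The ordinals [c] such
that the fibres over all [x < c] are bounded below [c] form a club; a point of
[S] in this club would be smaller than itself. *)
Lemma regressive_fiber (S : set W) (f : W -> W) : stationary S ->
  (forall a, S a -> f a < a) ->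
  (forall x, [set a | S a /\ f a = x] #<= [set: C]) -> False.
Proof.
move=> statS freg fC.
(* F x is a strict bound of the fibre over x *)
pose F x := projT1 (cid (card_bounded (fC x))).
have FP x a : S a -> f a = x -> a < F x.
  by move=> Sa fa; exact: (projT2 (cid (card_bounded (fC x)))).
pose K := [set c : W | forall x, x < c -> F x < c].
suff : club K.
  move=> /statS[a [Sa Ka]]; have := Ka _ (freg _ Sa).
  by apply/negP; rewrite -leNgt ltW//; exact: FP.
split.
  move=> c clc x xc.
  have [s cs hs] := succ_ex c.
  have : nbhs (c : order_topology W) [set` `]x, s[].
    rewrite itv_nbhsE; exists `]x, s[ => //; split => //=.
    by rewrite in_itv/= xc cs.
  move=> /clc[y [Ky]]; rewrite /= in_itv/= => /andP[xy /hs yc].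
  exact: lt_le_trans (Ky _ xy) yc.
move=> b.
have exn (a : W) : exists a', a < a' /\ forall x, x <= a -> F x < a'.
  have [|a' ha'] := @card_bounded ([set a] `|` F @` [set x | x <= a]).
    apply: absorbing_setU => //; first exact: absorbing_set1.
    exact: card_le_trans (card_image_le _ _) (card_segW a).
  exists a'; split; first by apply: ha'; left.
  by move=> x xa; apply: ha'; right; exists x.
pose nx a := projT1 (cid (exn a)).
have nxP a : a < nx a /\ forall x, x <= a -> F x < nx a
  by exact: (projT2 (cid (exn a))).
(* the supremum of the sequence u is closed under F *)
pose u n := iter n nx (nx b).
have uC : range u #<= [set: C].
  by apply: countable_absorbing => //; exact: card_image_le.
have [s us sl] := sup_ex uC.
exists s; last by apply: lt_le_trans (us (u 0%N) _);
  [exact: (nxP b).1|exists 0%N].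
move=> x xs.
have [n xn] : exists n, x <= u n.
  apply: contrapT => h; suff : s <= x by rewrite leNgt xs.
  apply: sl => _ [n _ <-]; case: (leP (u n) x) => // /ltW xn; by case: h;
    exists n.
apply: lt_le_trans (us (u n.+1) _); last by exists n.+1.
exact: (nxP (u n)).2.
Qed.

End least_ordinal_above.

(** * Ladders and disjoint tails *)

Section ladders.
Local Open Scope order_scope.

(** A ladder at [b]: a nondecreasing sequence of ordinals below [b] which is
cofinal in [b]. Repetitions are allowed. *)
Definition ladder d (W : orderType d) (b : W) (l : nat -> W) : Prop :=
  [/\ forall n, l n < b, forall m n, (m <= n)%N -> l m <= l n &
      forall c, c < b -> exists n, c < l n].

Lemma countable_unbounded_seq d (T : orderType d) (t0 : T) (A : set T) :
  unbounded A -> countable A ->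
  exists l : nat -> T, (forall m n, (m <= n)%N -> l m <= l n) /\
    forall c, exists n, c < l n.
Proof.
move=> ubA /(card_leTP 0%N)[f finj].
have /choice[e eP] : forall n, exists t, forall a, A a -> f a = n -> t = a.
  move=> n; have [[a [Aa <-]]|h] := pselect (exists a, A a /\ f a = n).
    by exists a => a' Aa' faa'; apply: finj; rewrite ?inE.
  by exists t0 => a Aa fa; case: h; exists a.
(* the running maxima of an enumeration of A *)
pose l := fix l n := if n is n'.+1 then Order.max (l n') (e n) else e 0%N.
have le n : e n <= l n by case: n => [|n] //=; rewrite le_max lexx orbT.
exists l; split.
  move=> m n mn; rewrite -(subnK mn); elim: (n - m)%N => // k IH.
  by rewrite addSn /= le_max IH.
move=> c; have [a Aa ca] := ubA c; exists (f a).
by apply: lt_le_trans ca _; rewrite -[a in a <= _](eP (f a) a).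
Qed.

Lemma ladder_below d (W : orderType d) (b : W) (A : set (below b)) :
  (exists x, x < b) -> unbounded A -> countable A -> exists l, ladder b l.
Proof.
move=> [x xb] ubA cA.
have [l [lm lc]] := countable_unbounded_seq (exist _ x xb : below b) ubA cA.
exists (fun n => \val (l n)); split => [n|m n /lm//|c cb];
  first exact: (valP (l n)).
by have [n cn] := lc (exist _ c cb : below b); exists n.
Qed.

Lemma cofinality_nat_ladder d (W : orderType d) (b : W) :
  cofinality_is (below b) nat -> exists l, ladder b l.
Proof.
move=> [[A ubA An] _]; apply: (ladder_below (A := A)) => //.
  have /set0P[a _] : A != set0.
    apply/eqP => A0; move: An; rewrite A0 card_eq_sym card_eq0 => /eqP.
    by rewrite -subset0 => /(_ 0%N); apply.
  by exists (\val a); exact: (valP a).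
by rewrite /countable; move: An; rewrite card_eq_le => /andP[].
Qed.

Lemma ladder_gt d (W : orderType d) (b : W) l c : ladder b l -> c < b ->
  exists k, forall m, (k <= m)%N -> c < l m.
Proof.
move=> [_ lm lc] /lc[k ck]; exists k => m /lm; exact: lt_le_trans.
Qed.

(** A ladder at [b] accumulates at no ordinal below [b]. *)
Lemma ladder_gap d (W : orderType d) (b : W) l a :
  ladder b l -> a < b -> (exists x, x < a) ->
  exists2 c, c < a & forall n, ~ (c < l n < a).
Proof.
move=> [lb lm lc] /lc[k ak] [x xa].
have exk : exists n, a <= l n by exists k; exact: ltW.
case: (ex_minnP exk) => -[|n] an nmin.
  exists x => // m /andP[_]; rewrite ltNge (le_trans an)//; exact: lm.
exists (l n).
  by rewrite ltNge; apply/negP => /nmin; rewrite ltnn.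
move=> m /andP[nm ma]; case: (leqP m n) => h.
  by move: nm; rewrite ltNge lm.
by move: ma; rewrite ltNge (le_trans an)// lm.
Qed.

(** A closed set accumulates at no ordinal outside it. The element [x] provides
a lower bound of the gap when [a] has a neighbourhood unbounded below. *)
Lemma club_gap d (T : orderType d) (F : set T) (a x : T) :
  closed (F : set (order_topology T)) -> ~ F a -> x < a ->
  exists2 c, c < a & forall y, F y -> ~ (c < y < a).
Proof.
move=> cF Fa xa.
have : ~ closure (F : set (order_topology T)) a by move=> /cF.
rewrite /closure/= => /existsNP[U /not_implyP[]].
rewrite itv_nbhsE => -[i [io ai] iU] nFU.
have sub y : y \in i -> ~ F y by move=> yi Fy; apply: nFU; exists y; split => //;
  exact: iU.
move: i io ai {iU} sub => [[[]l|[]] [[]r|[]]] //= _; rewrite in_itv/=.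
- move=> /andP[la ar] sub; exists l => // y Fy /andP[ly ya].
  by apply: (sub y) => //; rewrite in_itv/= ly (lt_trans ya).
- move=> /andP[la _] sub; exists l => // y Fy /andP[ly ya].
  by apply: (sub y) => //; rewrite in_itv/= ly.
- move=> ar sub; exists x => // y Fy /andP[_ ya].
  by apply: (sub y) => //; rewrite in_itv/= (lt_trans ya).
- by move=> _ sub; exists x => // y Fy _; apply: (sub y).
Qed.

End ladders.

Section disjoint_tails.
Local Open Scope order_scope.
Context {d} {W : orderType d} (S : set W) (l : W -> nat -> W).
Hypothesis wfW : well_founded (fun x y : W => x < y).
Hypothesis minW : forall P : set W, P !=set0 ->
  exists2 m, P m & forall y, P y -> m <= y.
Hypothesis lP : forall a, S a -> ladder a (l a).

(** The ladders at the points of [S] in [P] become pairwise disjoint when the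
first [n a] terms of the ladder at [a] are dropped. *)
Definition tails_disjoint (n : W -> nat) (P : set W) :=
  forall a a' m m', S a -> S a' -> P a -> P a' -> a < a' ->
    (n a <= m)%N -> (n a' <= m')%N -> l a m <> l a' m'.

(** Some cofinal subset [X] of [b] accumulates at no point of [S] below [b].
Points of [S] may belong to [X]. *)
Definition gapped (b : W) := exists X : set W,
  [/\ forall x, X x -> x < b, forall c, c < b -> exists2 x, X x & c <= x &
      forall a, S a -> a < b ->
        exists2 c, c < a & forall x, X x -> ~ (c < x < a)].

Hypothesis gappedW : forall b, (forall c, c < b -> exists2 x, x < b & c < x) ->
  gapped b.

(** Let [u a] be the least element of [X] not below [a]. Ladders at points with
the same [u] are separated by the hypothesis at [u a]. Otherwise, the tail of
the ladder at the larger point [a'] lies above [u a], because [X] leaves a gap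
[v a'] below [a']. *)
Lemma tails_disjoint_limit (b : W) :
  (forall c, c < b -> exists n, tails_disjoint n [set a | a <= c]) ->
  (forall c, c < b -> exists2 x, x < b & c < x) ->
  exists n, tails_disjoint n [set a | a < b].
Proof.
move=> IH /gappedW[X [Xb Xc Xgap]].
have /choice[N NP] : forall c, exists n, c < b ->
  tails_disjoint n [set a | a <= c].
  move=> c; have [cb|ncb] := pselect (is_true (c < b));
    last by exists (fun=> 0%N).
  by have [n hn] := IH c cb; exists n.
have /choice[u uP] : forall a, exists u, a < b ->
  [/\ X u, a <= u & forall x, X x -> a <= x -> u <= x].
  move=> a; have [ab|nab] := pselect (is_true (a < b)); last by exists a.
  have [|u [Xu au] um] := @minW [set x | X x /\ a <= x].
    by have [x Xx ax] := Xc a ab; exists x.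
  by exists u => _; split => // x Xx ax; apply: um.
have /choice[v vP] : forall a, exists v, S a -> a < b ->
  v < a /\ forall x, X x -> ~ (v < x < a).
  move=> a; have [[Sa ab]|h] := pselect (S a /\ a < b); last first.
    by exists a => Sa ab; case: h.
  by have [v va vx] := Xgap a Sa ab; exists v.
have /choice[k kP] : forall a, exists k, S a -> a < b -> forall m, (k <= m)%N ->
  v a < l a m.
  move=> a; have [[Sa ab]|h] := pselect (S a /\ a < b); last first.
    by exists 0%N => Sa ab; case: h.
  by have [k hk] := ladder_gt (lP Sa) (vP a Sa ab).1; exists k.
exists (fun a => maxn (N (u a) a) (k a)) => a a' m m' Sa Sa' /= ab a'b aa'.
rewrite !geq_max => /andP[Nm km] /andP[Nm' km'].
have [Xu au um] := uP a ab; have [Xu' au' um'] := uP a' a'b.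
have [a'u|ua'] := leP a' (u a).
  have uu : u a' = u a.
    by apply/eqP; rewrite eq_le um'//= um// (le_trans (ltW aa')).
  by apply: (NP (u a) (Xb _ Xu)) => //=; rewrite -uu.
have uv : u a <= v a' by rewrite leNgt; apply/negP => h;
  apply: ((vP a' Sa' a'b).2 _ Xu); rewrite h.
move=> e; have := kP a' Sa' a'b m' km'; rewrite -e => h.
have [lb _ _] := lP Sa; have := lt_trans (lb m) (le_lt_trans (le_trans au uv) h).
by rewrite ltxx.
Qed.

(** For [a < b], the ladder at [b] leaves a gap below [a], so a tail of the
ladder at [a] misses the ladder at [b] altogether. *)
Lemma tails_disjoint_le (b : W) n : tails_disjoint n [set a | a < b] ->
  exists n', tails_disjoint n' [set a | a <= b].
Proof.
move=> nP; have [Sb|nSb] := pselect (S b); last first.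
  have neb a : S a -> a <= b -> a < b by rewrite lt_neqAle => Sa ->;
    rewrite andbT; apply/eqP => ab; apply: nSb; rewrite -ab.
  by exists n => a a' m m' Sa Sa' /= ab ab'; apply: nP => //=; exact: neb.
have /choice[k kP] : forall a, exists k, S a -> a < b ->
  forall m j, (k <= m)%N -> l a m <> l b j.
  move=> a; have [[Sa ab]|h] := pselect (S a /\ a < b); last first.
    by exists 0%N => Sa ab; case: h.
  have [la lm lc] := lP Sa.
  have [c ca hc] := ladder_gap (lP Sb) ab (ex_intro (fun x =>
    is_true (x < a)) _ (la 0%N)).
  have [k hk] := ladder_gt (lP Sa) ca; exists k => _ _ m j km e.
  by apply: (hc j); rewrite -e hk//=.
exists (fun a => maxn (n a) (k a)) => a a' m m' Sa Sa' /= ab a'b aa'.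
rewrite !geq_max => /andP[nm km] /andP[nm' km'].
move: a'b; rewrite le_eqVlt => /predU1P[a'b|a'b].
  by rewrite a'b; apply: kP => //; rewrite -a'b.
by apply: nP => //=; exact: lt_trans a'b.
Qed.

Lemma exists_tails_disjoint (b : W) : exists n, tails_disjoint n [set a | a <= b].
Proof.
elim/(well_founded_ind wfW): b => b IH.
suff [n hn] : exists n, tails_disjoint n [set a | a < b]
  by exact: tails_disjoint_le hn.
have [[c cb hc]|h] := pselect (exists2 c, c < b & forall x, x < b -> x <= c).
  have [n hn] := IH c cb; exists n => a a' m m' Sa Sa' /= ab a'b.
  by apply: hn => //=; exact: hc.
apply: tails_disjoint_limit => // c cb; apply: contrapT => hx; apply: h.
exists c => // x xb; rewrite leNgt; apply/negP => cx; by apply: hx; exists x.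
Qed.
End disjoint_tails.

Section nonreflecting.
Local Open Scope order_scope.
Context {d1 d2} {omega1 : orderType d1} {omega2 : orderType d2}.
Hypothesis omega1P : least_ordinal_above nat omega1.
Hypothesis omega2P : least_ordinal_above omega1 omega2.
Variables (S : set omega2) (l : omega2 -> nat -> omega2).
Hypothesis lP : forall a, S a -> ladder a (l a).
Hypothesis S_nonreflecting : forall b : omega2, cofinality_is (below b) omega1 ->
       ~ stationary (trace_below S b).

(** If [b] has countable cofinality, take for [X] a ladder at [b]; otherwise [b]
has cofinality omega_1, and [X] is a club of [b] that misses [S]. *)
Lemma nonreflecting_gapped (b : omega2) :
  (forall c, c < b -> exists2 x, x < b & c < x) -> gapped S b.
Proof.
move=> blim.
have [[x xb]|nb] := pselect (exists x, x < b); last first.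
  by exists set0; split => // [c cb|a _ ab]; case: nb; [exists c|exists a].
have below_lt a : S a -> exists x, x < a by move=> /lP[la _ _]; exists (l a 0%N).
have [[A ubA cA]|ncA] :=
  pselect (exists2 A : set (below b), unbounded A & countable A).
  have [lb lbP] := ladder_below (ex_intro (fun x => is_true (x < b)) x xb) ubA cA.
  exists (range lb); split.
  - by move=> _ [n _ <-]; case: lbP.
  - by move=> c cb; case: lbP => _ _ /(_ c cb)[n cn]; exists (lb n);
      [exists n|exact: ltW].
  - move=> a Sa ab; have [c ca hc] := ladder_gap lbP ab (below_lt a Sa).
    by exists c => // _ [n _ <-]; exact: hc.
have ubcard (A : set (below b)) : unbounded A -> [set: omega1] #<= A.
  move=> ubA; apply: contrapT => /(card_le_of_not omega1P) cA.
  by apply: ncA; exists A.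
have ubT : @unbounded _ (below b) setT.
  move=> c; have [y yb cy] := blim (\val c) (valP c).
  by exists (exist _ y yb).
have /S_nonreflecting : cofinality_is (below b) omega1.
  split=> //; exists setT => //; rewrite card_eq_le ubcard// andbT.
  case: omega2P => _ _ /(_ b); apply: card_le_trans.
  apply: card_le_injP; exists \val; first by move=> ? ? _ _; exact: val_inj.
  by move=> y _; exact: (valP y).
move=> /existsNP[F /not_implyP[[cF ubF] /set0P/negP]]; rewrite negbK => /eqP F0.
exists (\val @` F); split.
- by move=> _ [y _ <-]; exact: (valP y).
- move=> c cb; have [y Fy cy] := ubF (exist _ c cb : below b).
  by exists (\val y); [exists y|exact: ltW].
- move=> a Sa ab; have [z za] := below_lt a Sa.
  pose a' : below b := exist _ a ab.
  pose z' : below b := exist _ z (lt_trans za ab).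
  have nFa : ~ F a' by move=> Fa; have : set0 a' by rewrite -F0.
  have [c ca hc] := club_gap cF nFa (za : z' < a').
  by exists (\val c) => // _ [y Fy <-]; exact: hc.
Qed.

End nonreflecting.

(** * The ladder space *)

Lemma ultra_bigcup_finite (T : Type) (I : choiceType) (F : set_system T)
    (G : set I) (A : I -> set T) :
  UltraFilter F -> finite_set G -> F (\bigcup_(i in G) A i) ->
    exists2 i, G i & F (A i).
Proof.
move=> FU Gfin FA; apply: contrapT => h.
have FF : ProperFilter F := ultra_proper.
suff : F set0 by exact: filter_not_empty.
have /filter_bigI FC : forall i, i \in fset_set G -> F (~` A i).
  move=> i; rewrite in_fset_set// inE => Gi.
  by have [FAi|//] := in_ultra_setVsetC (A i) FU; case: h; exists i.
apply: filterS (filterI FA FC) => x [[i Gi Aix]] /(_ i).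
by apply => //; rewrite /= in_fset_set// inE.
Qed.

Lemma open_separated_hausdorff (X : topologicalType) :
  (forall x y : X, x <> y -> exists2 U, open U &
    open (~` U) /\ (U x /\ ~ U y \/ U y /\ ~ U x)) ->
  hausdorff_space X.
Proof.
move=> h; rewrite open_hausdorff => x y /eqP/h[U oU [oU' [[Ux Uy]|[Uy Ux]]]].
  exists (U, ~` U); first by rewrite !inE.
  by split => //; rewrite setICr.
exists (~` U, U); first by rewrite !inE.
by split => //; rewrite setICl.
Qed.

(** [Some (inl x)] is the rung [x], [Some (inr a)] is the tip of [a] and [None]
is the point at infinity. Every ordinal has a tip; those outside [S] are
isolated points. The arguments [S] and [l] determine the topology only. *)
Definition ladder_space d (W : orderType d) (S : set W)
    (l : W -> nat -> W) : Type :=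
  option (W + W).

Section ladder_space.
Local Open Scope order_scope.
Local Open Scope classical_set_scope.
Context {d} {W : orderType d} (S : set W) (l : W -> nat -> W).
Local Notation K := (ladder_space S l).
Implicit Types U : set K.

Definition rung (x : W) : K := Some (inl x).
Definition tip (a : W) : K := Some (inr a).
Definition infty : K := None.

(** An open set that contains the tip of [a], for [a] in [S], contains a tail of
the ladder at [a]. One that contains infinity contains all the points except
finitely many tips, points of the ladders at these tips, and finitely many
rungs; the single finite set [G] bounds both exceptional tips and rungs. *)
Definition ladder_open U : Prop :=
  (forall a, S a -> U (tip a) -> exists k, forall m, (k <= m)%N ->
    U (rung (l a m))) /\
  (U infty -> exists2 G : set W, finite_set G & forall x, ~ G x -> U (tip x) /\
     (U (rung x) \/ exists a m, [/\ G a, S a & x = l a m])).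

Fact ladder_openT : ladder_open setT.
Proof.
split; first by move=> a _ _; exists 0%N.
by move=> _; exists set0; [exact: finite_set0|move=> x _; split => //; left].
Qed.

Fact ladder_openI : setI_closed ladder_open.
Proof.
move=> A B [A1 A2] [B1 B2]; split.
  move=> a Sa [/(A1 a Sa)[k Ak] /(B1 a Sa)[j Bj]].
  exists (maxn k j) => m; rewrite geq_max => /andP[km jm]; split;
    [exact: Ak|exact: Bj].
move=> [/A2[G Gf GA] /B2[H Hf HB]]; exists (G `|` H);
  first by rewrite finite_setU.
move=> x /not_orP[/GA[Ax Ax'] /HB[Bx Bx']]; split => //.
case: Ax' => [Ax'|[a [m [Ga Sa ->]]]]; last by right; exists a, m; split => //;
  left.
case: Bx' => [Bx'|[a [m [Ga Sa ->]]]]; last by right; exists a, m; split => //;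
  right.
by left.
Qed.

Fact ladder_open_bigcup (I : Type) (f : I -> set K) :
  (forall i, ladder_open (f i)) ->
  ladder_open (\bigcup_i f i).
Proof.
move=> fo; split.
  move=> a Sa [i _ fi]; have [k hk] := (fo i).1 a Sa fi.
  by exists k => m km; exists i => //; exact: hk.
move=> [i _ fi]; have [G Gf GP] := (fo i).2 fi.
exists G => // x /GP[fx fx']; split; first by exists i.
by case: fx' => [fx'|fx']; [left; exists i|right].
Qed.

HB.instance Definition _ := Choice.copy K (option (W + W)).
HB.instance Definition _ :=
  isOpenTopological.Build K ladder_openT ladder_openI ladder_open_bigcup.

Lemma ladder_openE U : open U <-> ladder_open U.
Proof.
rewrite openE; split => [oU|oU x Ux]; last by exists U; split.
have -> : U = \bigcup_(V : {V | ladder_open V /\ V `<=` U}) sval V.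
  apply/seteqP; split => [x /oU[V [oV Vx VU]]|x [[V [oV VU]] _ /= /VU]//].
  by exists (exist _ V (conj oV VU)).
by apply: ladder_open_bigcup => -[V [oV VU]].
Qed.

Lemma open_rungs U : (forall x, U x -> exists y, x = rung y) -> open U.
Proof.
by move=> h; apply/ladder_openE; split => [a Sa /h[]|/h[]].
Qed.

Lemma cvg_of_not_open (F : set_system K) (x : K) : UltraFilter F ->
  ~ (F --> x) -> exists U, [/\ open U, U x & F (~` U)].
Proof.
move=> FU nF; apply: contrapT => h; apply: nF => A;
  rewrite nbhsE => -[U [oU Ux] UA].
have FF : ProperFilter F := ultra_proper.
apply: filterS UA _.
have [//|FnU] := in_ultra_setVsetC U FU.
by case: h; exists U.
Qed.

Lemma cvg_principal (F : set_system K) (x : K) : Filter F -> F [set x] -> F --> x.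
Proof.
move=> FF Fx A /nbhs_singleton Ax; by apply: filterS Fx => _ ->.
Qed.

(** A neighbourhood of infinity leaves out finitely many branches and rungs. An
ultrafilter that contains one of these branches converges to its tip or
contains a finite set of rungs. *)
Lemma ladder_space_compact : compact [set: K].
Proof.
rewrite compact_ultra => F FU _; rewrite setTI.
have FF : ProperFilter F := ultra_proper.
have [|/(cvg_of_not_open FU)[U [/ladder_openE[_ oU] Uinf FnU]]] :=
  pselect (F --> infty).
  by exists infty.
have [G Gf GU] := oU Uinf.
pose V a := [set rung a] `|` [set tip a] `|` [set x | S a /\
  exists m, x = rung (l a m)].
have [|a Ga FVa] := ultra_bigcup_finite FU Gf (A := V).
  apply: filterS FnU => -[[x|x]|] nUx.
  - have [Gx|/GU[_ [//|[a [m [Ga Sa ->]]]]]] := pselect (G x).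
      by exists x => //; left; left.
    by exists a => //; right; split => //; exists m.
  - have [Gx|/GU[//]] := pselect (G x).
    by exists x => //; left; right.
  - by [].
have [|/(cvg_of_not_open FU)[Q [/ladder_openE[oO _] Oa FnO]]] :=
  pselect (F --> tip a).
  by exists (tip a).
have [k hk] : exists k, forall m, (k <= m)%N -> S a -> Q (rung (l a m)).
  have [Sa|nSa] := pselect (S a); last by exists 0%N.
  by have [k hk] := oO a Sa Oa; exists k => m /hk.
(* index 0 stands for the rung a, index m + 1 for the m-th term of the ladder *)
have [|m _ Fm] := @ultra_bigcup_finite _ _ F `I_k.+1 (fun m =>
  [set rung (if m is m'.+1 then l a m' else a)]) FU (finite_II _).
  apply: filterS (filterI FVa FnO) => x [[[->| ->]|[Sa [m ->]]] nO];
    [by exists 0%N|by case: nO|].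
  exists m.+1 => //=; rewrite ltnS ltnNge; apply/negP => /hk/(_ Sa); exact: nO.
by eexists; apply: cvg_principal; exact: Fm.
Qed.

Hypothesis lP : forall a, S a -> ladder a (l a).

Lemma ladder_avoid a x : S a -> exists k, forall m, (k <= m)%N -> l a m <> x.
Proof.
move=> Sa; have [xa|ax] := ltP x a.
  have [k hk] := ladder_gt (lP Sa) xa; exists k => m /hk xl lx.
  by move: xl; rewrite lx ltxx.
exists 0%N => m _ lx; have [la _ _] := lP Sa; have := la m.
by rewrite lx ltNge ax.
Qed.

Lemma clopen_rung x : open [set rung x] /\ open (~` [set rung x]).
Proof.
split; first by apply: open_rungs => y ->; exists x.
apply/ladder_openE; split.
  move=> a Sa _; have [k hk] := ladder_avoid x Sa.
  by exists k => m /hk h [].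
move=> _; exists [set x]; first exact: finite_set1.
by move=> y /= yx; split => //; left => -[].
Qed.

(** The tip of [a], with the ladder at [a] when [a] is in [S]; these sets are
clopen. *)
Definition branch (a : W) : set K :=
  [set tip a] `|` [set x | S a /\ exists m, x = rung (l a m)].

Lemma clopen_branch a : open (branch a) /\ open (~` branch a).
Proof.
split; apply/ladder_openE; split.
- move=> b Sb [[ba]|[_ [m]]]//; exists 0%N => m _; right.
  by move: Sb; rewrite ba => Sa; split => //; exists m.
- by move=> [|[_ []]].
- move=> b Sb nb.
  have [Sa|nSa] := pselect (S a); last by exists 0%N => m _ [|[]].
  have [k hk] : exists k, forall m j, (k <= m)%N -> l b m <> l a j.
    have [la lm lc] := lP Sa; have [lb _ _] := lP Sb.
    have [ab|ba|ab] := ltgtP a b.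
    - have [k hk] := ladder_gt (lP Sb) ab; exists k => m j /hk am e.
      by have := lt_trans am (_ : l b m < a); rewrite ltxx e => /(_ (la j)).
    - have [c cb hc] := ladder_gap (lP Sa) ba (ex_intro (fun x =>
        is_true (x < b)) _ (lb 0%N)).
      have [k hk] := ladder_gt (lP Sb) cb; exists k => m j /hk am e.
      by apply: (hc j); rewrite -e am lb.
    - by case: nb; left; rewrite /= ab.
  by exists k => m km [//|[_ [j [/hk]]]]; exact.
- move=> _; exists [set a]; first exact: finite_set1.
  move=> x /= xa; split; first by move=> [[]|[_ []]].
  have [[Sa [m xl]]|h] := pselect (S a /\ exists m, x = l a m).
    by right; exists a, m.
  by left => -[//|[Sa [m [xl]]]]; apply: h; split => //; exists m.
Qed.

Lemma ladder_space_hausdorff : hausdorff_space K.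
Proof.
apply: open_separated_hausdorff => x y xy.
have [[z [xz|yz]]|nd] := pselect (exists z, x = rung z \/ y = rung z).
- have [Uo Uc] := clopen_rung z; exists [set rung z] => //; split => //; left;
    split => //.
  by move=> /= yz; apply: xy; rewrite xz yz.
- have [Uo Uc] := clopen_rung z; exists [set rung z] => //; split => //; right;
    split => //.
  by move=> /= xz; apply: xy; rewrite xz yz.
have [[z [xz|yz]]|nt] := pselect (exists z, x = tip z \/ y = tip z).
- have [Uo Uc] := clopen_branch z; exists (branch z) => //; split => //; left;
    split; first by left.
  move=> [/= yz|[_ [m ym]]]; first by apply: xy; rewrite xz yz.
  by apply: nd; exists (l z m); right.
- have [Uo Uc] := clopen_branch z; exists (branch z) => //; split => //; right;
    split; first by left.
  move=> [/= xz|[_ [m xm]]]; first by apply: xy; rewrite xz yz.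
  by apply: nd; exists (l z m); left.
exfalso; move: x y xy nd nt => [[x|x]|] [[y|y]|] xy nd nt //;
  first [by apply: nd; exists x; left|by apply: nd; exists y; right|by apply: nt;
  exists x; left| by apply: nt; exists y; right].
Qed.

Lemma isolated_rung (A : set K) x : A (rung x) -> isolated A (rung x).
Proof.
move=> Ax; split; first exact/mem_set; exists [set rung x].
  by apply: open_nbhs_nbhs; split => //; exact: (clopen_rung x).1.
by apply/seteqP; split => [y []//|y ->].
Qed.

Lemma isolated_tip (A : set K) a : (forall x, ~ A (rung x)) -> A (tip a) ->
  isolated A (tip a).
Proof.
move=> nd Aa; split; first exact/mem_set; exists (branch a).
  by apply: open_nbhs_nbhs; split; [exact: (clopen_branch a).1|left].
apply/seteqP; split => [y [[//|[_ [m ->]]] /nd]//|y ->]; split => //; by left.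
Qed.

Lemma isolated_infty (A : set K) : (forall x, ~ A (rung x)) ->
  (forall x, ~ A (tip x)) ->
  A infty -> isolated A infty.
Proof.
move=> nd nt Ai; split; first exact/mem_set; exists setT; first exact: filterT.
by apply/seteqP; split => [[[x|x]|] [_ h]|y ->] //;
  [case: (nd _ h)|case: (nt _ h)].
Qed.

Lemma ladder_space_scattered : scattered K.
Proof.
move=> A [x0 Ax0].
have [[x Ax]|nd] := pselect (exists x, A (rung x)).
  by exists (rung x); exact: isolated_rung.
have {}nd x : ~ A (rung x) by move=> Ax; apply: nd; exists x.
have [[x Ax]|nt] := pselect (exists x, A (tip x)).
  by exists (tip x); exact: isolated_tip.
have {}nt x : ~ A (tip x) by move=> Ax; apply: nt; exists x.
exists infty; apply: isolated_infty => //.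
by case: x0 Ax0 => [[x /nd|x /nt]|].
Qed.

Lemma ladder_space_CB : CB_derived K 3 = set0.
Proof.
have d1 x : ~ CB_derived K 1 (rung x) by move=> [_]; apply; exact: isolated_rung.
have d2 x : ~ CB_derived K 2 (rung x) by move=> [/d1].
have t2 x : ~ CB_derived K 2 (tip x) by move=> [h]; apply; exact: isolated_tip.
rewrite -subset0 => -[[x|x]|] [h]; [by move: h => /d2|by move: h => /t2|].
by apply; exact: isolated_infty.
Qed.
End ladder_space.

(** * The ladder space is not Corson compact *)

Section not_Corson.
Local Open Scope order_scope.
Local Open Scope classical_set_scope.
Context {R : realType} {C : Type} {d} {W : orderType d}.
Context (S : set W) (l : W -> nat -> W).
Hypothesis aC : absorbing C.
Hypothesis WP : least_ordinal_above C W.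
Hypothesis lP : forall a, S a -> ladder a (l a).
Hypothesis statS : stationary S.
Local Notation K := (ladder_space S l).

(** A continuous function is [1 / (n + 1)]-close to its value at infinity at all
but finitely many tips, for each [n]. *)
Lemma countable_tips (phi : K -> R) : continuous phi ->
  countable [set a | phi (tip S l a) <> phi (infty S l)].
Proof.
move=> cphi.
have /choice[G GP] : forall n : nat, exists G : set W, finite_set G /\
    forall a, ~ G a -> (`|phi (tip S l a) - phi (infty S l)| < n.+1%:R^-1)%R.
  move=> n.
  have : open [set x : K | (`|phi x - phi (infty S l)| < n.+1%:R^-1)%R].
    have -> : [set x : K | (`|phi x - phi (infty S l)| < n.+1%:R^-1)%R]
      = phi @^-1` ball (phi (infty S l)) n.+1%:R^-1.
      by apply/seteqP; split => x /=; rewrite -ball_normE /= distrC.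
    by apply: open_comp => [x _|]; [exact: cphi|exact: ball_open].
  move=> /ladder_openE[_] [|G Gf GU];
    first by rewrite /= subrr normr0 invr_gt0 ltr0n.
  by exists G; split => // a /GU[].
apply: (@sub_countable _ _ _ (\bigcup_n G n)).
  apply: subset_card_le => a /eqP; rewrite -subr_eq0 -normr_gt0 => e0.
  apply: contrapT => h.
  have [n _ hn] := near_infty_natSinv_lt (PosNum e0).
  have := hn n (leqnn n); rewrite /= ltNge => /negP; apply.
  apply: ltW; apply: (GP n).2 => Ga; apply: h; by exists n.
by apply: bigcup_countable => // n _; exact: finite_set_countable (GP n).1.
Qed.

(** The coordinate [i a] separates the tip of [a] from infinity, and also the
rung [f a < a]; hence it is in the support of the image of that rung or of
infinity. *)
Lemma ladder_space_no_embedding (I : Type) (h : K -> I -> R) :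
  (forall i, continuous (fun x => h x i)) -> injective h ->
  (forall x, [set i | h x i <> 0%R] #<= [set: C]) -> False.
Proof.
move=> hc hinj hC.
have /choice[i iP] : forall a, exists i, h (tip S l a) i <> h (infty S l) i.
  move=> a; apply: contrapT => nex; suff : tip S l a = infty S l by [].
  by apply: hinj; apply/funext => i; apply: contrapT => hi; apply: nex; exists i.
have /choice[f fP] : forall a, exists b, S a ->
  b < a /\ h (rung S l b) (i a) <> h (infty S l) (i a).
  move=> a; have [Sa|nSa] := pselect (S a); last by exists a.
  have : open [set x : K | h x (i a) <> h (infty S l) (i a)].
    have -> : [set x : K | h x (i a) <> h (infty S l) (i a)] =
        (fun x => h x (i a)) @^-1` (~` [set h (infty S l) (i a)]) by [].
    apply: open_comp => [x _|]; first exact: hc.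
    by apply: closed_openC; apply: accessible_closed_set1;
      apply: hausdorff_accessible; exact: norm_hausdorff.
  move=> /ladder_openE[/(_ a Sa (iP a))[k hk] _].
  by exists (l a k) => _; split; [case: (lP Sa)|exact: hk].
apply: (regressive_fiber aC WP statS (f := f)) => [a Sa|x];
  first exact: (fP a Sa).1.
pose N := [set j | h (rung S l x) j <> 0%R] `|` [set j | h (infty S l) j <> 0%R].
apply: (@card_le_trans _ _ _ (\bigcup_(j in N) [set a | h (tip S l a)
  j <> h (infty S l) j])).
  apply: subset_card_le => a [Sa fa]; exists (i a); last exact: iP.
  have [_] := fP a Sa; rewrite fa /N /=.
  apply: contra_notP => /not_orP[/contrapT -> /contrapT ->//].
apply: card_bigcup_le => //.
  by apply: absorbing_setU => //; exact: hC.
by move=> j _; apply: countable_absorbing => //; exact: (countable_tips (hc j)).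
Qed.

Lemma ladder_space_not_lt_Corson : ~ lt_Corson_compact R W K.
Proof.
move=> [_ [I [A [Asupp [f [g [fc _ fK _]]]]]]].
apply: (@ladder_space_no_embedding I (fun x => \val (f x))).
- move=> i.
  have vc : continuous (fun y : set_type A => \val y : {ptws I -> R})
    by exact: initial_continuous.
  pose Ie := HB.pack I (gen_eqMixin I) : eqType.
  have ec : continuous (fun y : {ptws I -> R} => y i) :=
    @proj_continuous Ie (fun=> R) i.
  have vec : continuous (fun y : set_type A => (\val y : {ptws I -> R}) i).
    by move=> y; exact: (cvg_comp _ _ (vc y) (ec _)).
  by move=> x; exact: (cvg_comp _ _ (fc x) (vec _)).
- by move=> x y /val_inj /(can_inj fK).
- move=> x; apply: (card_le_of_not WP); apply: (Asupp (\val (f x)));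
    exact: set_valP.
Qed.

Lemma ladder_space_not_Corson : ~ Corson_compact R K.
Proof.
move=> [KX [I [A [Asupp hA]]]]; apply: ladder_space_not_lt_Corson.
split => //; exists I, A; split => // x /Asupp cx WA; case: WP => _ + _; apply.
apply: card_le_trans WA _; exact: countable_absorbing.
Qed.
End not_Corson.

(** * The Hilbert space of square summable families *)

#[local] Existing Instance totally_filter.

Section l2.
Local Open Scope ring_scope.
Variables (R : realType) (I : choiceType).
(** The families with bounded finite sums of squares. *)
Definition square_summable : {pred I -> R} :=
  fun f => `[< exists M, forall J : {fset I}, \sum_(i <- J) f i ^+ 2 <= M >].
Lemma square_summableP f :
  reflect (exists M, forall J : {fset I}, \sum_(i <- J) f i ^+ 2 <= M)
    (f \in square_summable).
Proof. exact: asboolP. Qed.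
Lemma square_summable_submod : submod_closed square_summable.
Proof.
split.
  apply/square_summableP; exists 0 => J.
  by rewrite big1// => i _; rewrite expr0n.
move=> a u v /square_summableP[M uM] /square_summableP[N vN].
apply/square_summableP; exists (2 * (a ^+ 2 * M + N)) => J.
apply: (@le_trans _ _ (2 * (a ^+ 2 * (\sum_(i <- J) u i ^+ 2) + \sum_(i <- J)
  v i ^+ 2))).
  rewrite mulr_sumr -big_split/= mulr_sumr ler_sum// => i _.
  have := sqr_ge0 (a * u i - v i).
  rewrite -[(a *: u + v) i]/(a * u i + v i) => h.
  by rewrite -subr_ge0; apply: le_trans h _; rewrite le_eqVlt; apply/orP; left;
    apply/eqP; ring.
by rewrite ler_pM2l// lerD// ler_wpM2l// sqr_ge0.
Qed.
HB.instance Definition _ := GRing.isSubmodClosed.Build R (I ->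
  R) square_summable square_summable_submod.
(** The square summable real families indexed by [I], which need not be
countable. *)
Record l2 := L2 { l2_val :> I -> R; _ : l2_val \in square_summable }.
HB.instance Definition _ := [isSub for l2_val].
HB.instance Definition _ := [Choice of l2 by <:].
HB.instance Definition _ := [SubChoice_isSubLmodule of l2 by <:].

Lemma l2P (f : l2) : exists M, forall J : {fset I}, \sum_(i <- J) f i ^+ 2 <= M.
Proof. by case: f => f /= /square_summableP. Qed.

Lemma l2ext (f g : l2) : (forall i, f i = g i) -> f = g.
Proof. by move=> fg; apply: val_inj; apply/funext. Qed.

Lemma l2D (f g : l2) i : (f + g) i = f i + g i. Proof. by []. Qed.
Lemma l2Z a (f : l2) i : (a *: f) i = a * f i. Proof. by []. Qed.
Lemma l2B (f g : l2) i : (f - g) i = f i - g i. Proof. by []. Qed.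
Lemma l20 i : (0 : l2) i = 0. Proof. by []. Qed.

Lemma fset_sum_le (h : I -> R) (J K : {fset I}) : (J `<=` K)%fset ->
  (forall i, 0 <= h i) ->
  \sum_(i <- J) h i <= \sum_(i <- K) h i.
Proof.
move=> JK h0; rewrite [leRHS](big_fsetID _ (mem J))/=.
rewrite (_ : [fset x in K | mem J x]%fset = J); last first.
  by apply/fsetP => i; rewrite !inE/=; case: (boolP (i \in J)) => iJ;
    rewrite ?andbF// (fsubsetP JK).
by rewrite lerDl sumr_ge0.
Qed.

(** The partial sum over a finite set of indices; the sums over all indices are
limits along the directed set of the finite sets of indices. *)
Definition psum (f g : I -> R) (J : {fset I}) : R := \sum_(i <- J) f i * g i.

Lemma is_cvg_psum_sqr (f : l2) : cvg (psum f f @ totally).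
Proof.
have [M fM] := l2P f.
have ge0 i : 0 <= f i * f i by rewrite -expr2 sqr_ge0.
pose E := range (psum f f).
have hs : has_sup E.
  split; first by exists (psum f f fset0), fset0.
  by exists M => _ [J _ <-]; rewrite /psum; under eq_bigr do rewrite -expr2;
    exact: fM.
apply/cvg_ex; exists (sup E); apply/cvgrPdist_le => /= e e0.
have [_ [J _ <-] Je] := sup_adherent e0 hs.
exists J => // K /= JK.
have h1 : psum f f J <= psum f f K by exact: fset_sum_le.
have h2 : psum f f K <= sup E by apply: ub_le_sup; [exact: hs.2|exists K].
by rewrite ger0_norm; lra.
Qed.

(** By polarization. *)
Lemma is_cvg_psum (f g : l2) : cvg (psum f g @ totally).
Proof.
have -> : psum f g = (fun J => 4^-1 * (psum (f + g : l2) (f + g :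
  l2) J - psum (f - g : l2) (f - g : l2) J)).
  apply/funext => J; rewrite /psum -sumrB mulr_sumr; apply: eq_bigr => i _.
  by rewrite l2D l2B; field.
by apply: is_cvgZr; apply: is_cvgB; exact: is_cvg_psum_sqr.
Qed.

(** The inner product. *)
Definition l2dot (f g : l2) : R := lim (psum f g @ totally).

Lemma l2dotE (f g : l2) l : psum f g @ totally --> l -> l2dot f g = l.
Proof. by move=> /(cvg_lim _); exact. Qed.

Lemma cvg_l2dot (f g : l2) : psum f g @ totally --> l2dot f g.
Proof. exact: is_cvg_psum. Qed.

Lemma l2dotC f g : l2dot f g = l2dot g f.
Proof.
apply: l2dotE; rewrite (_ : psum f g = psum g f); first exact: cvg_l2dot.
by apply/funext => J; apply: eq_bigr => i _; rewrite mulrC.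
Qed.

Lemma l2dotPl a f g h : l2dot (a *: f + g) h = a * l2dot f h + l2dot g h.
Proof.
apply: l2dotE; rewrite (_ : psum _ h = (fun J => a * psum f h J + psum g h J)).
  by apply: cvgD; [apply: cvgMr|]; exact: cvg_l2dot.
apply/funext => J; rewrite /psum mulr_sumr -big_split.
by apply: eq_bigr => i _; rewrite (l2D (a *: f) g) (l2Z a f) mulrDl mulrA.
Qed.

Lemma l2dot_ge_psum (f : l2) J : psum f f J <= l2dot f f.
Proof.
have ge0 i : 0 <= f i * f i by rewrite -expr2 sqr_ge0.
apply: limr_ge; first exact: is_cvg_psum.
by exists J => // K /= JK; exact: fset_sum_le.
Qed.

Lemma l2dot_le (f : l2) M : (forall J, psum f f J <= M) -> l2dot f f <= M.
Proof.
move=> h; apply: limr_le; first exact: is_cvg_psum.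
by apply: nearW.
Qed.

Lemma l2dot_ge0 f : 0 <= l2dot f f.
Proof. by apply: le_trans (l2dot_ge_psum f fset0);
  rewrite /psum big_seq_fset0. Qed.

Lemma l2dot_ge_coord (f : l2) i : f i ^+ 2 <= l2dot f f.
Proof. by apply: le_trans (l2dot_ge_psum f [fset i]%fset);
  rewrite /psum big_seq_fset1 expr2. Qed.

Lemma l2dot_eq0 f : l2dot f f = 0 -> f = 0.
Proof.
move=> f0; apply: l2ext => i; apply/eqP;
  rewrite l20 -sqrf_eq0 eq_le sqr_ge0 andbT -f0.
exact: l2dot_ge_coord.
Qed.

Fact l2dot_linearl g : linear_for *%R (l2dot ^~ g).
Proof. by move=> a f h; rewrite l2dotPl. Qed.
Fact l2dot_linearr f : linear_for (idfun \; *%R) (l2dot f).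
Proof. by move=> a g h; rewrite l2dotC l2dotPl ![l2dot _ f]l2dotC. Qed.

Fact l2dot_sym f g : l2dot f g = (-1) ^+ false * idfun (l2dot g f).
Proof. by rewrite expr0 mul1r l2dotC. Qed.
Fact l2dot_gt0 (f : l2) : f != 0 -> 0 < l2dot f f.
Proof. by move=> f0; rewrite lt_def l2dot_ge0 andbT; apply: contra_neq f0;
  exact: l2dot_eq0. Qed.
HB.instance Definition _ :=
  bilinear_isBilinear.Build R l2 l2 R *%R (idfun \;
    *%R) l2dot (l2dot_linearl, l2dot_linearr).
HB.instance Definition _ :=
  isHermitianSesquilinear.Build R l2 false idfun l2dot l2dot_sym.
HB.instance Definition _ := isDotProduct.Build R l2 l2dot l2dot_gt0.

Lemma l2dotDl f g h : l2dot (f + g) h = l2dot f h + l2dot g h.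
Proof. by rewrite -[f]scale1r l2dotPl mul1r scale1r. Qed.
Lemma l2dotZl a f h : l2dot (a *: f) h = a * l2dot f h.
Proof.
have h0 : l2dot 0 h = 0 by have /= := l2dotPl (-1) 0 0 h; rewrite scaler0 addr0;
  lra.
by rewrite -[a *: f]addr0 l2dotPl h0 addr0.
Qed.
Lemma l2dotDr f g h : l2dot h (f + g) = l2dot h f + l2dot h g.
Proof. by rewrite ![l2dot h _]l2dotC l2dotDl. Qed.
Lemma l2dotZr a f h : l2dot h (a *: f) = a * l2dot h f.
Proof. by rewrite ![l2dot h _]l2dotC l2dotZl. Qed.

Lemma l2_Cauchy_Schwarz f g : l2dot f g ^+ 2 <= l2dot f f * l2dot g g.
Proof.
have [g0|g0] := eqVneq (l2dot g g) 0.
  rewrite (l2dot_eq0 g0) -[0 in leLHS](scale0r f) -[0 in leRHS](scale0r f).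
  by rewrite !(l2dotZr,l2dotZl) !mul0r mulr0 expr0n.
have gp : 0 < l2dot g g by rewrite lt_def g0 l2dot_ge0.
have := l2dot_ge0 (l2dot g g *: f + (- l2dot f g) *: g).
rewrite !(l2dotDl,l2dotDr,l2dotZl,l2dotZr) [l2dot g f]l2dotC => h.
by rewrite -(ler_pM2l gp); nra.
Qed.

(** The Hilbert norm. *)
Definition l2norm (f : l2) : R := Num.sqrt (l2dot f f).

Lemma sqr_l2norm f : l2norm f ^+ 2 = l2dot f f.
Proof. by rewrite sqr_sqrtr// l2dot_ge0. Qed.

Fact l2normD f g : l2norm (f + g) <= l2norm f + l2norm g.
Proof.
have nn h : 0 <= l2norm h by exact: sqrtr_ge0.
rewrite -(@ler_pXn2r _ 2)// ?nnegrE ?addr_ge0// sqrrD !sqr_l2norm.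
rewrite !(l2dotDl,l2dotDr) [l2dot g f]l2dotC.
have : `|l2dot f g| <= l2norm f * l2norm g.
  by rewrite -(@ler_pXn2r _ 2)// ?nnegrE ?mulr_ge0// exprMn !sqr_l2norm
    real_normK ?num_real// l2_Cauchy_Schwarz.
have := ler_norm (l2dot f g); lra.
Qed.

Fact l2normZ a f : l2norm (a *: f) = `|a| * l2norm f.
Proof.
by rewrite /l2norm l2dotZl l2dotZr mulrA -expr2 sqrtrM ?sqr_ge0// sqrtr_sqr.
Qed.

Fact l2norm_eq0 f : l2norm f = 0 -> f = 0.
Proof.
by move=> f0; apply: l2dot_eq0; rewrite -sqr_l2norm f0 expr0n.
Qed.

HB.instance Definition _ :=
  Lmodule_isNormed.Build R l2 l2normD l2normZ l2norm_eq0.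

Lemma l2_normE (f : l2) : `|f| = l2norm f. Proof. by []. Qed.

Lemma l2_coord_le (f : l2) i : `|f i| <= `|f|.
Proof.
rewrite -(@ler_pXn2r _ 2)// ?nnegrE// l2_normE sqr_l2norm real_normK ?num_real//.
exact: l2dot_ge_coord.
Qed.

(** A Cauchy filter converges pointwise, and the bounds on finite sums of
squares pass to the pointwise limit. *)
Lemma l2_complete (F : set_system l2) : ProperFilter F -> cauchy F -> cvg F.
Proof.
move=> FF /cauchyP cF.
have cFi i : cvg ((fun h : l2 => h i) @ F).
  apply: R_complete; apply: cauchy_exP => e e0.
  have [x Fx] := cF e e0; exists (x i).
  suff xsub : ball x e `<=` (fun h : l2 => ball (x i) e (h i))
    by exact: filterS xsub Fx.
  move=> h; rewrite -!ball_normE /= => xh; apply: le_lt_trans xh.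
  by rewrite -(l2B x h); exact: l2_coord_le.
pose f i := lim ((fun h : l2 => h i) @ F).
have key e : 0 < e -> exists2 x : l2, F (ball x e) &
    forall h, ball x e h -> forall J :
      {fset I}, \sum_(i <- J) (h i - f i) ^+ 2 <= (2 * e) ^+ 2.
  move=> e0; have [x Fx] := cF e e0; exists x => // h xh J.
  have cvgJ : (fun k : l2 => \sum_(i <- J) (h i - k i) ^+ 2) @ F -->
    \sum_(i <- J) (h i - f i) ^+ 2.
    apply: (@cvg_big R _ +%R 0 xpredT) => [|i _]; first exact: add_continuous.
    rewrite expr2; under eq_fun do rewrite expr2.
    by apply: cvgM; apply: cvgB;
      [exact: cvg_cst|exact: cFi|exact: cvg_cst|exact: cFi].
  rewrite -(cvg_lim _ cvgJ)//; apply: limr_le; first by apply/cvg_ex; eexists;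
    exact: cvgJ.
  suff sub : ball x e `<=` (fun k :
    l2 => \sum_(i <- J) (h i - k i) ^+ 2 <= (2 * e) ^+ 2).
    exact: filterS sub Fx.
  move=> k xk.
  have hk : `|h - k| <= 2 * e.
    rewrite -(subrK x h) -addrA; apply: le_trans (ler_normD _ _) _.
    move: xh xk; rewrite -!ball_normE/= [X in X < e -> _]distrC => ? ?.
    by rewrite mulr_natl mulr2n lerD// ltW.
  apply: (@le_trans _ _ (`|h - k| ^+ 2)); last first.
    by rewrite ler_pXn2r// nnegrE ?mulr_ge0// ltW.
  rewrite l2_normE sqr_l2norm; apply: le_trans (l2dot_ge_psum _ J).
  by rewrite /psum; apply: ler_sum => i _; rewrite (l2B h k) expr2.
have [x1 _ hx1] := key 1 ltr01.
have fin : f \in square_summable.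
  have : (x1 : I -> R) - f \in square_summable.
    by apply/square_summableP; exists ((2 * 1) ^+ 2); exact/hx1/ballxx.
  have x1in : (x1 : I -> R) \in square_summable by exact: valP.
  move=> /(rpredB x1in); rewrite opprB addrCA subrr addr0; exact.
apply/cvg_ex; exists (L2 fin); apply/cvgrPdist_le => /= e e0.
have [x Fx hx] := key (e / 2) (divr_gt0 e0 (ltr0Sn _ _)).
apply: filterS Fx => h /hx{}hx.
rewrite -(@ler_pXn2r _ 2)// ?nnegrE// ?(ltW e0)//.
rewrite distrC l2_normE sqr_l2norm; apply: l2dot_le => J.
rewrite (_ : e = 2 * (e / 2)); last by field.
by apply: le_trans (hx J); apply: ler_sum => i _; rewrite l2B expr2.
Qed.
HB.instance Definition _ := Uniform_isComplete.Build l2 l2_complete.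

Lemma l2_hilbert_norm : @hilbert_norm R l2 l2dot.
Proof. by move=> f; rewrite l2_normE sqr_l2norm. Qed.

(** The coordinate functionals. *)
Definition l2coord (i : I) (f : l2) : R := f i.
Fact l2coord_linear i : linear_for *%R (l2coord i).
Proof. by move=> a f g. Qed.
HB.instance Definition _ i :=
  GRing.isLinear.Build R l2 R *%R (l2coord i) (l2coord_linear i).

Lemma l2coord_continuous i : continuous (l2coord i).
Proof.
apply: (@bounded_linear_continuous R l2 R^o (l2coord i)).
apply/linear_boundedP; exists 1; split => // r r1 f.
by apply: le_trans (l2_coord_le f i) _; rewrite ler_peMl// ltW.
Qed.

Fact l2unit_subproof (i : I) : (fun j => (j == i)%:R : R) \in square_summable.
Proof.
apply/square_summableP; exists 1 => J.
have [iJ|iJ] := boolP (i \in J).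
  rewrite (big_fsetD1 i)//= eqxx expr1n big1_seq ?addr0// => j.
  by rewrite !inE => /andP[_ /andP[/negbTE-> _]]; rewrite expr0n.
rewrite big1_seq// => j /andP[_ jJ].
by rewrite (_ : j == i = false) ?expr0n//; apply: contraNF iJ => /eqP <-.
Qed.
(** The vectors of the standard orthonormal basis. *)
Definition l2unit i : l2 := L2 (l2unit_subproof i).

Lemma l2unitE i j : l2unit i j = (j == i)%:R. Proof. by []. Qed.

Lemma l2_sumE (r : seq I) (F : I -> l2) i :
  (\sum_(j <- r) F j) i = \sum_(j <- r) F j i.
Proof. exact: (big_morph (fun f : l2 => f i) (fun f g => l2D f g i) (l20 i)). Qed.

(** A linear combination of [n] basis vectors with coefficients of absolute
value at most 1 has norm at most the square root of [n], but [phi] takes a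
value at least [n * e] on the one with the right signs. *)
Lemma finite_functional_l2unit (phi : {scalar l2}) (e : R) :
  continuous (phi : l2 -> R) -> 0 < e ->
    finite_set [set i | e <= `|phi (l2unit i)|].
Proof.
move=> cphi e0.
have [M M0 hM] : exists2 M, 0 < M & forall x, `|phi x| <= M * `|x|.
  have /linear_boundedP/pinfty_ex_gt0[M M0 hM] : bounded_near phi (nbhs (0 : l2)).
    by apply: continuous_linear_bounded; exact: cphi.
  by exists M.
apply: contrapT => inf.
(* M ^ 2 < e ^ 2 * n, whereas the estimate below gives (e * n) ^ 2 <= M ^ 2 * n *)
pose n := (Num.truncn (M ^+ 2 / e ^+ 2)).+1.
have [J JA nJ] := infinite_set_fset n inf.
pose s i := Num.sg (phi (l2unit i)).
pose x : l2 := \sum_(i <- J) s i *: l2unit i.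
have phix : e * #|` J|%:R <= `|phi x|.
  rewrite /x linear_sum/= (eq_bigr (fun i => `|phi (l2unit i)|)); last first.
    by move=> i _; rewrite linearZ/= normrEsg.
  rewrite ger0_norm ?sumr_ge0// -sum1_size natr_sum mulr_sumr big_seq
    [leRHS]big_seq.
  by apply: ler_sum => i /JA iA; rewrite mulr1.
have xJ i : x i = if i \in J then s i else 0.
  rewrite /x l2_sumE; case: ifPn => iJ.
    rewrite (big_fsetD1 i)// big1_seq; last first.
      move=> j; rewrite !inE => /andP[_ /andP[ji _]].
      by rewrite (l2Z (s j) (l2unit j)) l2unitE eq_sym (negbTE ji) mulr0.
    by rewrite (l2Z (s i) (l2unit i)) l2unitE eqxx mulr1 /= addr0.
  rewrite big1_seq// => j /andP[_ jJ].
  rewrite (l2Z (s j) (l2unit j)) l2unitE (_ : i == j = false) ?mulr0//.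
  by apply: contraNF iJ => /eqP ->.
have normx : `|x| ^+ 2 <= #|` J|%:R.
  rewrite l2_normE sqr_l2norm; apply: l2dot_le => K; rewrite /psum.
  have s1 i : s i * s i <= 1.
    rewrite /s -expr2 sqr_sg; by case: eqP.
  apply: (@le_trans _ _ (\sum_(i <- K) if i \in J then 1 else 0)).
    by apply: ler_sum => i _; rewrite xJ; case: ifP; rewrite ?mulr0.
  rewrite -big_mkcond/= -sum1_size natr_sum.
  rewrite -big_filter (perm_big [fset i in K | i \in J]%fset)/=; last first.
    apply: uniq_perm => [||i]; rewrite ?filter_uniq ?fset_uniq//.
    by rewrite mem_filter !inE/= andbC.
  by apply: (fset_sum_le (h := fun=> 1)) => //; apply/fsubsetP => i;
    rewrite !inE/= => /andP[].
have J0 : 0 < #|` J|%:R :> R by rewrite ltr0n (leq_trans _ nJ).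
have : (e * #|` J|%:R) ^+ 2 <= M ^+ 2 * #|` J|%:R.
  apply: (@le_trans _ _ ((M * `|x|) ^+ 2)).
    rewrite ler_pXn2r// ?nnegrE ?mulr_ge0// ?(ltW e0)// ?(ltW M0)//.
    exact: le_trans phix (hM x).
  by rewrite exprMn ler_pM2l ?exprn_gt0.
rewrite exprMn [X in _ * X]expr2 mulrA ler_pM2r// -ler_pdivlMl ?exprn_gt0// mulrC.
apply/negP; rewrite -ltNge; apply: lt_le_trans (truncnS_gt _) _.
by rewrite ler_nat.
Qed.
End l2.

(** * Weakly compact copies of compact spaces *)

Section weak_topology.
Context {R : realType} {E : normedModType R}.

Lemma weak_space_continuous (X : topologicalType) (j : X -> E) :
  (forall phi : continuous_dual E, continuous (fun x => sval phi (j x))) ->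
  continuous (j : X -> weak_space E).
Proof.
move=> jc x; apply/cvg_sup => phi.
by have := @continuous_comp_initial E X R (sval phi) j (jc phi) x.
Qed.

Lemma continuous_dual_weak (phi : continuous_dual E) :
  continuous (fun x : weak_space E => sval phi x : R).
Proof.
move=> x A Ax.
have := @initial_continuous E R (sval phi) x A Ax.
have /cvg_sup/(_ phi) : nbhs (x : weak_space E) --> (x : weak_space E)
  by exact: cvg_id.
by apply.
Qed.
End weak_topology.

Lemma hausdorff_separating_functions (X Y : topologicalType) :
  hausdorff_space Y ->
  (forall x y : X, x <> y -> exists2 f : X -> Y, continuous f & f x <> f y) ->
    hausdorff_space X.
Proof.
move=> hY sep x y cxy; apply: contrapT => /sep[f fc]; apply;
  apply: hY => A B fA fB.
have [z [Az Bz]] := cxy _ _ (fc x A fA) (fc y B fB).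
by exists (f z).
Qed.

(** A continuous map from a compact space onto a Hausdorff space is a quotient
map. *)
Lemma compact_quotient_open (X Y : topologicalType) (f : X -> Y) (A : set Y) :
  compact [set: X] -> hausdorff_space Y -> continuous f -> range f = [set: Y] ->
  open (f @^-1` A) -> open A.
Proof.
move=> cX hY fc fT oA; rewrite -[A]setCK; apply: closed_openC.
have -> : ~` A = f @` (~` (f @^-1` A)).
  apply/seteqP; split => [y Ay|_ [x Ax <-] //].
  have [x _ fx] : range f y by rewrite fT.
  by exists x => //=; rewrite fx.
apply: (compact_closed hY); apply: (@continuous_compact _ _ f).
  exact: continuous_subspaceT.
by apply: (subclosed_compact _ cX) => //; exact: open_closedC.
Qed.

Lemma compact_homeomorphic_range (X Y : topologicalType) (j : X -> Y) :
  compact [set: X] -> hausdorff_space Y -> continuous j -> injective j ->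
  homeomorphic X (set_type (range j)).
Proof.
move=> cX hY jc jinj.
pose f (x : X) : set_type (range j) := SigSub (mem_set (ex_intro2 _ _ x I erefl)).
have fc : continuous f by apply: continuous_comp_initial; exact: jc.
have hS : hausdorff_space (set_type (range j)).
  apply: hausdorff_separating_functions hY _ => x y xy; exists \val;
    first exact: initial_continuous.
  by move=> /val_inj.
have /choice[g gP] : forall y : set_type (range j), exists x, f x = y.
  move=> y; have [x _ xy] := set_valP y; exists x; exact: val_inj.
have fK : cancel f g by move=> x; apply: jinj; have /(congr1 \val) := gP (f x).
exists f, g; split => //; apply/continuousP => A oA.
apply: compact_quotient_open cX hS fc _ _.
  by apply/seteqP; split => // y _; exists (g y).
rewrite (_ : f @^-1` _ = A)//; apply/seteqP; split => x /=; by rewrite fK.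
Qed.

Lemma finite_bigcap_nbhs (X : topologicalType) (I : choiceType) (x : X)
    (G : set I) (A : I -> set X) :
  finite_set G -> (forall i, G i -> nbhs x (A i)) ->
    nbhs x (\bigcap_(i in G) A i).
Proof.
move=> Gf GA; have -> : G = [set` fset_set G] by rewrite fset_setK.
by apply: filter_bigI => i; rewrite in_fset_set// inE; exact: GA.
Qed.

Lemma nbhs_finite_setC (X : topologicalType) (x : X) (G : set X) :
  hausdorff_space X ->
  finite_set G -> ~ G x -> nbhs x (~` G).
Proof.
move=> hX Gf Gx.
have -> : ~` G = \bigcap_(i in G) (~` [set i]).
  by apply/seteqP; split => [y Gy i Gi /= yi|y h Gy]; [apply: Gy;
    rewrite yi|exact: (h y Gy)].
apply: finite_bigcap_nbhs => // i Gi; apply: open_nbhs_nbhs; split.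
  by apply: closed_openC; apply: accessible_closed_set1;
    exact: hausdorff_accessible.
by move=> /= xi; apply: Gx; rewrite xi.
Qed.

Section disjoint_neighborhoods.
Local Open Scope ring_scope.
Context {R : realType} {L : topologicalType} (p : L) (D : set L) (U : L -> set L).
Hypothesis cL : compact [set: L].
Hypothesis hL : hausdorff_space L.
Hypothesis isoL : forall x, ~ D x -> x <> p -> open [set x].
Hypothesis oU : forall d, D d -> open (U d).
Hypothesis Ud : forall d, D d -> U d d.
Hypothesis Up : forall d, D d -> nbhs p (~` U d).
Hypothesis Udisj : forall d d' x, D d -> D d' -> U d x -> U d' x -> d = d'.

Let I : choiceType := (L + L)%type.
Let H := l2 R I.
Let e (i : I) : H := l2unit R i.

(** The space [L] consists of a point [p], of the points of a set [D] with
pairwise disjoint open neighbourhoods [U], none of which accumulates at [p],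
and of isolated points. The embedding [j] sends [x] to the sum of the basis
vector [e (inl y)], if [x] is in [U y], and of the basis vector [e (inr x)], if
[x] is neither [p] nor in [D]. *)
Theorem disjoint_neighborhoods_uniform_Eberlein : uniform_Eberlein_compact R L.
Proof.
have /choice[u uP] : forall x, exists u : H,
    (forall d, D d -> U d x -> u = e (inl d)) /\ ((forall d, D d -> ~ U d x) ->
      u = 0).
  move=> x; have [[d [Dd Udx]]|h] := pselect (exists d, D d /\ U d x).
    exists (e (inl d)); split; last by move=> /(_ d Dd).
    by move=> d' Dd' Ud'x; rewrite (Udisj Dd Dd' Udx Ud'x).
  by exists 0; split => // d Dd Udx; case: h; exists d.
have /choice[v vP] : forall x, exists v : H,
    (D x \/ x = p -> v = 0) /\ (~ (D x \/ x = p) -> v = e (inr x)).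
  by move=> x; have [h|h] := pselect (D x \/ x = p);
    [exists 0|exists (e (inr x))].
pose j x := u x + v x.
have uD d x : D d -> U d x -> u x = e (inl d) by move=> Dd; exact: (uP x).1.
have up : u p = 0 by apply: (uP p).2 => d Dd; exact: nbhs_singleton (Up Dd).
have vD x : D x -> v x = 0 by move=> Dx; apply: (vP x).1; left.
have vp : v p = 0 by apply: (vP p).1; right.
have ucase x : (exists2 d, D d /\ U d x & u x = e (inl d)) \/ u x = 0.
  have [[d [Dd Udx]]|h] := pselect (exists d, D d /\ U d x).
    by left; exists d => //; exact: uD.
  by right; apply: (uP x).2 => d Dd Udx; apply: h; exists d.
have vcase x : v x = 0 \/ v x = e (inr x).
  by have [/(vP x).1|/(vP x).2] := pselect (D x \/ x = p); [left|right].
have uinr x y : u x (inr y) = 0 by case: (ucase x) => [[d _ ->]|->].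
have vinl x y : v x (inl y) = 0 by case: (vcase x) => ->.
have jinl x y : j x (inl y) = u x (inl y) by rewrite /j l2D vinl addr0.
have jinr x y : j x (inr y) = v x (inr y) by rewrite /j l2D uinr add0r.
have jiso x y : ~ (D x \/ x = p) -> j x = j y -> x = y.
  move=> /(vP x).2 vx jxy.
  have := jinr x x; rewrite jxy jinr vx /e l2unitE eqxx.
  case: (vcase y) => ->; first by rewrite l20 => /eqP; rewrite eq_sym oner_eq0.
  rewrite l2unitE; case: eqP => [[->//]|_ /eqP]; by rewrite eq_sym oner_eq0.
have jD x y : D x -> j x = j y -> D y \/ y = p -> x = y.
  move=> Dx jxy Dy; have := jinl x x; rewrite jxy jinl (uD x x)//; last exact: Ud.
  rewrite l2unitE eqxx; case: Dy => [Dy|->].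
    rewrite (uD y y)//; last exact: Ud.
    rewrite l2unitE; case: eqP => [[->//]|_ /eqP]; by rewrite eq_sym oner_eq0.
  by rewrite up l20 => /eqP; rewrite eq_sym oner_eq0.
have jinj : injective j.
  move=> x y jxy.
  have [hx|hx] := pselect (D x \/ x = p); last exact: jiso.
  have [hy|hy] := pselect (D y \/ y = p); last by apply/esym; exact: jiso.
  case: hx => [Dx|xp]; first exact: jD.
  case: hy => [Dy|yp]; last by rewrite xp yp.
  by apply/esym; apply: jD => //; right.
have jc : continuous (j : L -> weak_space H).
  apply: weak_space_continuous => -[phi cphi] /= x.
  apply/cvgrPdist_lt => eps eps0.
  have [[Dx|->]|hx] := pselect (D x \/ x = p).
(* near x in D, the first term of j is constant and the second one is small *)
  - have Ff := finite_functional_l2unit cphi eps0.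
    pose G := [set y | eps <= `|phi (e (inr y))| /\ y <> x].
    have Gf : finite_set G.
      apply: (@sub_finite_set _ _ (inr @^-1` [set i | eps <= `|phi (l2unit R
        i)|])).
        by move=> y [].
      by apply: finite_preimage Ff => ? ? _ _ [].
    have nx : nbhs x (~` G) by apply: nbhs_finite_setC => // -[_]; apply.
    have Ux : nbhs x (U x) by apply: open_nbhs_nbhs; split; [exact: oU|exact: Ud].
    apply: filterS (filterI nx Ux) => y [Gy Uxy].
    rewrite -linearB/= /j (vD x Dx) (uD x x)//; last exact: Ud.
    rewrite (uD x y)// addr0 opprD addrA subrr add0r linearN normrN.
    case: (vcase y) => [->|vy]; first by rewrite linear0 normr0.
    have [yx|yx] := eqVneq y x; first by rewrite yx vD// linear0 normr0.
    by rewrite vy ltNge; apply/negP => h; apply: Gy; split => //; exact/eqP.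
(* near p, both terms of j are small *)
  - have eps20 : 0 < eps / 2 by rewrite divr_gt0.
    have Ff := finite_functional_l2unit cphi eps20.
    pose G := [set y | eps / 2 <= `|phi (e (inr y))| /\ y <> p].
    have Gf : finite_set G.
      apply: (@sub_finite_set _ _ (inr @^-1` [set i | eps / 2 <= `|phi (l2unit R
        i)|])).
        by move=> y [].
      by apply: finite_preimage Ff => ? ? _ _ [].
    pose G' := [set d | eps / 2 <= `|phi (e (inl d))| /\ D d].
    have G'f : finite_set G'.
      apply: (@sub_finite_set _ _ (inl @^-1` [set i | eps / 2 <= `|phi (l2unit R
        i)|])).
        by move=> y [].
      by apply: finite_preimage Ff => ? ? _ _ [].
    have np : nbhs p (~` G) by apply: nbhs_finite_setC => // -[_]; apply.
    have np' : nbhs p (\bigcap_(d in G') ~` U d).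
      by apply: finite_bigcap_nbhs => // d [_]; exact: Up.
    apply: filterS (filterI np np') => y [Gy G'y].
    rewrite -linearB/= /j up vp addr0 sub0r linearN normrN linearD.
    apply: le_lt_trans (ler_normD _ _) _; rewrite [eps]splitr.
    apply: ltrD.
      case: (ucase y) => [[d [Dd Udy] ->]|->]; last by rewrite linear0 normr0.
      by rewrite ltNge; apply/negP => h; apply: (G'y d).
    case: (vcase y) => [->|vy]; first by rewrite linear0 normr0.
    have [yx|yx] := eqVneq y p; first by rewrite yx vp linear0 normr0.
    by rewrite vy ltNge; apply/negP => h; apply: Gy; split => //; exact/eqP.
  - have : nbhs x [set x].
      apply: open_nbhs_nbhs; split => //; apply: isoL => h; apply: hx;
        [by left|by right].
    by apply: filterS => y ->; rewrite subrr normr0.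
have hW : hausdorff_space (weak_space H).
  apply: (hausdorff_separating_functions (@Rhausdorff R)) => f g fg.
  have [i fgi] : exists i, f i <> g i.
    apply: contrapT => h; apply: fg; apply: (l2ext (f := f)) => i.
    by apply: contrapT => fgi; apply: h; exists i.
  pose phi : continuous_dual H :=
    exist _ (l2coord i : {scalar H}) (@l2coord_continuous R I i).
  by exists (sval phi) => //; exact: continuous_dual_weak.
split => //; exists H, (@l2dot R I : {dot H for idfun}), (range (j : L ->
  weak_space H)); split.
- exact: l2_hilbert_norm.
- apply: continuous_compact => //; exact: continuous_subspaceT.
- exact: compact_homeomorphic_range.
Qed.
End disjoint_neighborhoods.

(** * Continuous images of the ladder space *)

(** In a graph whose degrees are countable, the components are countable.
Enumerate each of them and let [B x] be the set of the elements that come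
before [x] in the enumeration of its component: these sets are finite, and each
edge joins some [x] to an element of [B x]. *)
Lemma locally_countable_orientation (T : Type) (r : T -> T -> Prop) :
  (forall x, countable [set y | r x y]) -> (forall x y, r x y -> r y x) ->
  exists B : T -> set T, [/\ forall x, finite_set (B x), forall x, ~ B x x &
    forall x y, r x y -> x <> y -> B x y \/ B y x].
Proof.
move=> rc rsym.
pose step (A : set T) := A `|` \bigcup_(x in A) [set y | r x y].
pose comp x := \bigcup_n iter n step [set x].
have comp_refl x : comp x x by exists 0%N.
have comp_countable x : countable (comp x).
  apply: bigcup_countable => // n _; elim: n => [|n IH] /=;
    first exact: countable1.
  rewrite /step -bigcup2E; apply: bigcup_countable => // -[|[|k]] _ //=.
  exact: bigcup_countable.
have comp_step x y z : comp x y -> r y z -> comp x z.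
  by move=> [n _ ny] yz; exists n.+1 => //=; right; exists y.
have comp_sub x y : comp x y -> comp y `<=` comp x.
  move=> xy z [n _]; elim: n z => [z /= ->//|n IH z /= [/IH//|[t /IH xt tz]]].
  exact: comp_step tz.
have comp_eq x y : r x y -> comp x = comp y.
  move=> xy; apply/seteqP; split; apply: comp_sub.
    by apply: comp_step (comp_refl y) _; exact: rsym.
  exact: comp_step (comp_refl x) xy.
(* the enumeration is attached to the set, so as to be common to a component *)
have /choice[h hP] : forall A : set T, exists f : T -> nat, countable A ->
  {in A &, injective f}.
  move=> A; have [/(card_leTP 0%N)[f' f'P]|nA] := pselect (countable A);
    first by exists f'.
  by exists (fun=> 0%N).
exists (fun x => [set y | comp y = comp x /\ (h (comp x) y < h (comp x) x)%N]);
  split.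
- move=> x; apply: (@card_le_finite _ _ _ `I_(h (comp x) x));
    last exact: finite_II.
  apply: card_le_injP; exists (h (comp x)); last by move=> y [].
  move=> y z /set_mem[yx _] /set_mem[zx _]; apply: (hP _ (comp_countable x));
    rewrite inE.
    by rewrite -yx.
  by rewrite -zx.
- by move=> x [_]; rewrite ltnn.
- move=> x y xy nxy; have e := comp_eq x y xy.
  have [hxy|hyx|hxy] := ltngtP (h (comp x) x) (h (comp x) y).
  + by right; split => //; rewrite -e.
  + by left; split.
  + case: nxy; apply: (hP _ (comp_countable x)) => //; rewrite inE //;
      by rewrite e.
Qed.

Section image.
Local Open Scope order_scope.
Local Open Scope classical_set_scope.
Context {R : realType} {d} {W : orderType d} (S : set W) (l : W -> nat -> W).
Local Notation K := (ladder_space S l).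
Local Notation rung := (@rung d W S l).
Local Notation tip := (@tip d W S l).
Context {L : topologicalType} (g : K -> L).
Hypothesis hL : hausdorff_space L.
Hypothesis gc : continuous g.
Hypothesis gT : range g = [set: L].
Let p : L := g (infty S l).

Lemma preimage_ladder_open (V : set L) : open V -> ladder_open (g @^-1` V).
Proof. by move=> oV; apply/ladder_openE; move/continuousP : gc; exact. Qed.

Lemma image_open (V : set L) : ladder_open (g @^-1` V) -> open V.
Proof.
move=> /ladder_openE; apply: (compact_quotient_open _ hL gc gT).
exact: ladder_space_compact.
Qed.

Lemma open_setC1 (y : L) : open (~` [set y]).
Proof.
by apply: closed_openC; apply: accessible_closed_set1;
  exact: hausdorff_accessible.
Qed.

Lemma open_setC_finite (G : set L) : finite_set G -> open (~` G).
Proof. by move=> Gf; rewrite openE => x Gx; exact: nbhs_finite_setC. Qed.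

Lemma countable_outside (V : set L) : open V -> V p ->
  countable [set x : W | ~ V (g (rung x)) \/ ~ V (g (tip x))].
Proof.
move=> /preimage_ladder_open[_ Vp] /Vp[G Gf GP].
apply: (@sub_countable _ _ _ (G `|` \bigcup_(a in G) range (l a))).
  apply: subset_card_le => x nV; have [Gx|/GP[tx dx]] := pselect (G x);
    first by left.
  case: dx => [dx|[a [m [Ga _ xl]]]]; first by case: nV.
  by right; exists a => //; exists m.
rewrite -bigcup2E; apply: bigcup_countable => // -[|[|k]] _ //=;
  first exact: finite_set_countable.
apply: bigcup_countable => [|a _]; first exact: finite_set_countable.
by apply: card_le_trans (card_image_le _ _) _.
Qed.

Lemma finite_tips_outside (V : set L) :
  open V -> V p -> finite_set [set a : W | ~ V (g (tip a))].
Proof.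
move=> /preimage_ladder_open[_ Vp] /Vp[G Gf GP].
by apply: sub_finite_set Gf => a nV; apply: contrapT => /GP[].
Qed.

(** The images of the tips of [S], other than the image of infinity. *)
Let D := [set y | y <> p /\ exists2 a, S a & g (tip a) = y].

(** The preimage of such a point contains no tip of [S] and not infinity, so it
is open. *)
Lemma image_isolated y : ~ D y -> y <> p -> open [set y].
Proof.
move=> Dy yp; apply: image_open; split.
  by move=> a Sa /= ga; case: Dy; split => //; exists a.
by move=> /= ip; case: yp.
Qed.

(** Outside a neighbourhood of [p] there are only finitely many points of [D]. *)
Lemma image_isolating_nbhs y : D y -> exists V : set L,
  [/\ open V, V y, nbhs p (~` V) & forall x, V x -> D x -> x = y].
Proof.
move=> [yp _].
move: hL; rewrite open_hausdorff => /(_ y p)[]; first exact/eqP.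
move=> [A B] /= [/set_mem Ay /set_mem Bp] [oA oB /eqP AB].
pose G := (g \o tip) @` [set a | ~ B (g (tip a))] `\` [set y].
have Gf : finite_set G by apply: finite_setD; apply: finite_image;
  exact: finite_tips_outside.
have nAB x : A x -> ~ B x by move=> Ax Bx; have : (A `&` B) x by []; rewrite AB.
exists (A `&` ~` G); split.
- by apply: openI => //; exact: open_setC_finite.
- by split => // -[_]; apply.
- by apply: filterS (open_nbhs_nbhs (conj oB Bp)) => x Bx [/nAB].
- move=> x [/nAB nBx Gx] [_ [a Sa gax]]; apply: contrapT => xy; apply: Gx;
    split => //.
  by exists a => //; rewrite /= gax.
Qed.

Variable n : W -> nat.
Hypothesis nP : forall a a' m m', S a -> S a' -> g (tip a) <> p ->
  g (tip a') <> p ->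
  (n a <= m)%N -> (n a' <= m')%N -> l a m = l a' m' -> a = a'.

(** The images of the tails of all the ladders whose tips are mapped to [y]. *)
Let tails y := [set x | exists a m, [/\ S a, g (tip a) = y,
  (n a <= m)%N & x = g (rung (l a m))]].

Lemma finite_tip_fiber y : D y -> finite_set [set a | g (tip a) = y].
Proof.
move=> [yp _]; apply: sub_finite_set (finite_tips_outside (open_setC1 y) _).
  by move=> a /= ga; apply.
by move=> /= e; apply: yp.
Qed.

Lemma countable_tails y : D y -> countable (tails y).
Proof.
move=> Dy; apply: (@sub_countable _ _ _ (\bigcup_(a in [set a | g (tip a) = y])
  range (fun m => g (rung (l a m))))).
  by apply: subset_card_le => x [a [m [Sa ga _ ->]]]; exists a => //; exists m.
apply: bigcup_countable => [|a _]; first by apply: finite_set_countable;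
  exact: finite_tip_fiber.
by apply: card_le_trans (card_image_le _ _) _.
Qed.

Lemma finite_tails_outside y (V : set L) : D y -> open V -> V y ->
  finite_set (tails y `\` V).
Proof.
move=> Dy oV Vy.
have /choice[k kP] : forall a, exists k, S a -> g (tip a) = y ->
  forall m, (k <= m)%N -> V (g (rung (l a m))).
  move=> a; have [[Sa ga]|h] := pselect (S a /\ g (tip a) = y); last first.
    by exists 0%N => Sa ga; case: h.
  have [Vo _] := preimage_ladder_open oV.
  have [|k hk] := Vo a Sa; first by rewrite /= ga.
  by exists k.
apply: (@sub_finite_set _ _ (\bigcup_(a in [set a | g (tip a) = y]) ((fun m =>
  g (rung (l a m))) @` `I_(k a)))).
  move=> x [[a [m [Sa ga _ ->]]] nV]; exists a => //; exists m => //=.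
  by rewrite ltnNge; apply/negP => /(kP a Sa ga).
apply: bigcup_finite => [|a _]; first exact: finite_tip_fiber.
by apply: finite_image; exact: finite_II.
Qed.

(** Only countably many rungs are mapped to [x], and each of them lies on the
tail of at most one ladder. *)
Lemma countable_tails_through x : x <> p -> countable [set y | D y /\ tails y x].
Proof.
move=> xp.
have cf := countable_outside (open_setC1 x) (fun e => xp (esym e)).
apply: (@sub_countable _ _ _ (\bigcup_(z in [set z :
  W | ~ (~` [set x]) (g (rung z)) \/ ~ (~` [set x]) (g (tip z))])
   [set y | D y /\ exists a m, [/\ S a, g (tip a) = y,
     (n a <= m)%N & z = l a m]])).
  apply: subset_card_le => y [Dy [a [m [Sa ga nm xl]]]]; exists (l a m).
    by left; apply.
  by split => //; exists a, m.
apply: bigcup_countable => // z _.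
have [[y hy]|h] := pselect (exists y, D y /\ exists a m, [/\ S a, g (tip a) = y,
  (n a <= m)%N & z = l a m]); last first.
  apply: (@sub_countable _ _ _ set0); last exact: countable0.
  by apply: subset_card_le => y hy; case: h; exists y.
apply: (@sub_countable _ _ _ [set y]); last exact: countable1.
apply: subset_card_le => y' [[y'p _] [a' [m' [Sa' ga' nm' zl']]]].
have [[yp _] [a [m [Sa ga nm zl]]]] := hy.
rewrite /= -ga -ga'; congr (g (tip _)); apply: (nP (m := m') (m' := m)) => //.
- by rewrite ga'.
- by rewrite ga.
- by rewrite -zl'.
Qed.

Theorem ladder_space_image_uniform_Eberlein : uniform_Eberlein_compact R L.
Proof.
have /choice[V VP] : forall y, exists V : set L, D y ->
    [/\ open V, V y, nbhs p (~` V) & forall x, V x -> D x -> x = y].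
  move=> y; have [Dy|nDy] := pselect (D y); last by exists set0.
  by have [V hV] := image_isolating_nbhs Dy; exists V.
(* U0 y is an open neighbourhood of y, all other points of which are isolated *)
pose U0 y := [set y] `|` (tails y `&` V y).
have U0V y : D y -> U0 y `<=` V y by move=> Dy x [->|[]//]; have [] := VP y Dy.
have U0D y x : D y -> U0 y x -> D x -> x = y.
  by move=> Dy /(U0V y Dy) Vx Dx; have [_ _ _] := VP y Dy; apply.
have U0p y : D y -> ~ U0 y p.
  by move=> Dy /(U0V y Dy) Vp; have [_ _ /nbhs_singleton nVp _] := VP y Dy;
    exact: nVp.
have oU0 y : D y -> open (U0 y).
  move=> Dy; have [oV Vy _ _] := VP y Dy; apply: image_open; split;
    last by move=> /U0p; case.
  move=> a Sa /= ga.
  have gay : g (tip a) = y.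
    apply: (U0D y _ Dy ga); split; last by exists a.
    by move=> gap; apply: (U0p y Dy); rewrite -gap.
  have [Vo _] := preimage_ladder_open oV.
  have [|k hk] := Vo a Sa; first by rewrite /= gay.
  exists (maxn (n a) k) => m; rewrite geq_max => /andP[nm km]; right; split;
    last exact: hk.
  by exists a, m.
have U0fin y y' : D y -> D y' -> y <> y' -> finite_set (U0 y `&` U0 y').
  move=> Dy Dy' yy'.
  move: hL; rewrite open_hausdorff => /(_ y y')[]; first exact/eqP.
  move=> [A B] /= [/set_mem Ay /set_mem By'] [oA oB /eqP AB].
  apply: (@sub_finite_set _ _ ((tails y `\` A) `|` (tails y' `\` B))).
    move=> x [Ux Ux'].
    have xy : x <> y by move=> xy; apply: yy'; apply: U0D Dy' _ Dy; rewrite -xy.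
    have xy' : x <> y' by move=> xy'; apply: yy'; apply/esym;
      apply: U0D Dy _ Dy'; rewrite -xy'.
    case: Ux => [//|[tx _]]; case: Ux' => [//|[tx' _]].
    have [Ax|nAx] := pselect (A x); last by left.
    right; split => // Bx; have : (A `&` B) x by [].
    by rewrite AB.
  by rewrite finite_setU; split; exact: finite_tails_outside.
pose r y y' := [/\ D y, D y' & U0 y `&` U0 y' !=set0].
have [|y y' [Dy Dy' [x [Ux Ux']]]|B [Bfin Birr BP]] :=
  @locally_countable_orientation L r.
- move=> y; have [Dy|nDy] := pselect (D y); last first.
    apply: (@sub_countable _ _ _ set0); last exact: countable0.
    by apply: subset_card_le => y' [].
  apply: (@sub_countable _ _ _ ([set y] `|` \bigcup_(x in tails y `\` [set p])
    [set y' | D y' /\ tails y' x])).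
    apply: subset_card_le => y' [_ Dy' [x [Ux Ux']]].
    have [->|yy'] := eqVneq y' y; first by left.
    right; exists x.
      split; last by move=> /= xp; apply: (U0p y Dy); rewrite -xp.
      case: Ux => [xy|[]//]; exfalso; move/eqP: yy'; apply; apply/esym.
      by apply: (U0D y' y Dy' _ Dy); rewrite -xy.
    split => //; case: Ux' => [xy|[]//]; exfalso; move/eqP: yy'; apply.
    by apply: (U0D y y' Dy _ Dy'); rewrite -xy.
  rewrite -bigcup2E; apply: bigcup_countable => // -[|[|k]] _ //=.
  apply: bigcup_countable => [|x [_ xp]]; last exact: countable_tails_through.
  by apply: sub_countable (countable_tails Dy); exact: card_le_setD.
- by split => //; exists x.
(* removing the finite sets G y makes these neighbourhoods disjoint *)
pose G y := \bigcup_(y' in B y `&` D) (U0 y `&` U0 y').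
pose U y := U0 y `&` ~` G y.
apply: (@disjoint_neighborhoods_uniform_Eberlein R L p D U) => //.
- rewrite -gT; apply: (@continuous_compact _ _ g setT);
    first exact: continuous_subspaceT.
  exact: ladder_space_compact.
- exact: image_isolated.
- move=> y Dy; apply: openI; first exact: oU0.
  apply: open_setC_finite; apply: bigcup_finite => [|y' [By' Dy']].
    by apply: sub_finite_set (Bfin y) => y' [].
  by apply: U0fin => // yy'; apply: (Birr y); rewrite {2}yy'.
- move=> y Dy; split; first by left.
  move=> [y' [By' Dy'] [_ Uy']]; apply: (Birr y).
  by rewrite {2}(U0D y' y Dy' Uy' Dy).
- move=> y Dy; have [_ _ np _] := VP y Dy.
  suff VU : ~` V y `<=` ~` U y by exact: filterS VU np.
  by move=> x nVx [/(U0V y Dy)/nVx].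
- move=> y y' x Dy Dy' [Ux nG] [Ux' nG']; apply: contrapT => yy'.
  have ryy' : r y y' by split => //; exists x.
  by case: (BP y y' ryy' yy') => [By'|By]; [apply: nG; exists y'|apply: nG';
    exists y].
Qed.
End image.

(** * The theorem *)

Theorem theorem3p6 (R : realType) (d1 d2 : Order.disp_t)
    (omega1 : orderType d1) (omega2 : orderType d2)
    (omega1P : least_ordinal_above nat omega1)
    (omega2P : least_ordinal_above omega1 omega2)
    (S : set omega2) (S_stationary : stationary S)
    (S_cof : forall a : omega2, S a -> cofinality_is (below a) nat)
    (S_nonreflecting : forall b : omega2, cofinality_is (below b) omega1 ->
       ~ stationary (trace_below S b)) :
  exists K : topologicalType,
    [/\ compact_hausdorff K,
        scattered K,
        CB_derived K 3 = set0,
        ~ Corson_compact R K /\ ~ lt_Corson_compact R omega2 K &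
        forall (L : topologicalType) (g : K -> L),
          hausdorff_space L -> continuous g -> range g = [set: L] ->
          weight_le L omega1 -> uniform_Eberlein_compact R L].
Proof.
have a1 : absorbing omega1 := absorbing_succ absorbing_nat omega1P.
have /choice[l lS] : forall a, exists l : nat -> omega2, S a -> ladder a l.
  move=> a; have [/S_cof/cofinality_nat_ladder[l lP]|nSa] := pselect (S a);
    first by exists l.
  by exists (fun=> a).
have lP a : S a -> ladder a (l a) := lS a.
exists (ladder_space S l); split.
- by split; [exact: ladder_space_compact|exact: ladder_space_hausdorff].
- exact: ladder_space_scattered.
- exact: ladder_space_CB.
- split; [exact: (ladder_space_not_Corson a1 omega2P)|exact:
    (ladder_space_not_lt_Corson a1 omega2P)].
move=> L g hL gc gT [B [Bopen Bbase] Bcard].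
pose p := g (infty S l).
(* g maps the rung and the tip of all ordinals but omega_1 many to the point p,
   hence those of all ordinals from some b on *)
pose Z := [set x | g (rung S l x) <> p \/ g (tip S l x) <> p].
have Zcard : Z #<= [set: omega1].
  apply: (@card_le_trans _ _ _ (\bigcup_(V in [set V | B V /\ V p])
      [set x | ~ V (g (rung S l x)) \/ ~ V (g (tip S l x))])).
    apply: subset_card_le => x Zx.
    have sep y : y <> p -> exists V, [/\ B V, V p & ~ V y].
      move=> yp; have [|V [BV Vp] Vy] := Bbase p (~` [set y]).
        by apply: open_nbhs_nbhs; split; [exact: open_setC1|move=> /= py;
          apply: yp].
      by exists V; split => // /Vy; apply.
    by case: Zx => /sep[V [BV Vp nV]]; exists V => //; [left|right].
  apply: card_bigcup_le => //.
    by apply: card_le_trans Bcard; apply: subset_card_le => V [].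
  move=> V [/Bopen oV Vp]; apply: countable_absorbing => //.
  exact: (countable_outside gc oV Vp).
have [b Zb] := card_bounded a1 omega2P Zcard.
have [n nP] : exists n, tails_disjoint S l n [set a | (a <= b)%O].
  apply: (exists_tails_disjoint (lt_wf omega2P) (wo_minP omega2P) lP).
  exact: (nonreflecting_gapped omega1P omega2P lP S_nonreflecting).
apply: (ladder_space_image_uniform_Eberlein hL gc gT (n := n)).
move=> a a' m m' Sa Sa' ga ga' nm nm' e.
have ab : (a <= b)%O by apply/ltW/Zb; right.
have a'b : (a' <= b)%O by apply/ltW/Zb; right.
have [h|h|h] := ltgtP a a'; last exact: h.
  by have /(_ e) := nP a a' m m' Sa Sa' ab a'b h nm nm'.
by have /(_ (esym e)) := nP a' a m' m Sa' Sa a'b ab h nm' nm.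
Qed.
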